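(* Let $d\ge 1$, $M\in\mathbb{N}$ with $M\ge 2$, $p\in(M^{-d},1]$, and let $F$ be a fractal percolation on $[0,1]^d$ with parameters $M$ and $p$. For $k\in\{0,\ldots,d\}$ let $Z^k_\infty:=\lim_{n\to\infty}M^{(k-D)n}V_k(F_n)$ (almost sure limit). Then, for each $k\in\{0,\ldots,d\}$, the limit variable $Z^k_\infty$ has mean $\overline{\mathcal V}_k(F)$ and positive and finite variance given by $$\mathrm{Var}(Z^k_\infty)=(\overline{\mathcal V}_k(F))^2\cdot\mathrm{Var}(W_\infty)=(\overline{\mathcal V}_k(F))^2\cdot\frac{1-p}{M^dp-1}.$$ Moreover, for any $k,\ell\in\{0,\ldots,d\}$, $$\mathrm{Cov}(Z^k_\infty,Z^\ell_\infty)=\overline{\mathcal V}_k(F)\cdot\overline{\mathcal V}_\ell(F)\cdot\mathrm{Var}(W_\infty)=\overline{\mathcal V}_k(F)\cdot\overline{\mathcal V}_\ell(F)\cdot\frac{1-p}{M^dp-1}.$$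
   Context: Fractal percolation: Let $J=[0,1]^d$, $\Sigma=\{1,\ldots,M^d\}$, let $J_1,\ldots,J_{M^d}$ be the $M^d$ closed subcubes of side length $1/M$ into which $J$ is divided, and let $\varphi_j$ be the homothetic (rotation- and reflection-free) similarity mapping $J$ onto $J_j$. For $\sigma=\sigma_1\ldots\sigma_n\in\Sigma^n$ let $J_\sigma=\varphi_{\sigma_1}\circ\cdots\circ\varphi_{\sigma_n}(J)$, and for $m\le n$ let $\sigma|m=\sigma_1\ldots\sigma_m$. Let $\{Y_\sigma:\sigma\in\bigcup_{n\ge1}\Sigma^n\}$ be i.i.d. Bernoulli variables with parameter $p$. Put $F_0=J$ and, for $n\ge1$, let $F_n$ be the union of all $J_\sigma$, $\sigma\in\Sigma^n$, with $Y_{\sigma|1}=\cdots=Y_{\sigma|n}=1$ (the retained cubes of level $n$). The fractal percolation is $F=\bigcap_n F_n$. $D:=\log(M^dp)/\log M$. $V_0,\ldots,V_d$ denote the intrinsic volumes, extended additively to finite unions of compact convex sets, with $V_k(\emptyset)=0$. $N_n$ is the number of retained cubes of level $n$ (with $N_0=1$); it is a Galton–Watson process with $\mathrm{Bin}(M^d,p)$ offspring distribution, $\mathbb{E}N_n=(M^dp)^n$, and $W_n:=N_n/\mathbb{E}N_n$ is a nonnegative martingale, with almost sure limit $W_\infty$. $\overline{\mathcal V}_k(F):=\lim_{n\to\infty}M^{n(k-D)}\mathbb{E}V_k(F_n)$; this limit is known to exist for every $k\in\{0,\ldots,d\}$ and $p\in(0,1]$. For $p>M^{-d}$ the almost sure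 limit $Z^k_\infty$ exists.
   Formalization: Positivity of the variance is claimed only when p<1 and the limit functional V̄_k(F) is nonzero; for p=1 or V̄_k(F)=0 the stated formula itself gives variance 0, so positivity fails there. *)

(* Defs.v *)
From HB Require Import structures.
From mathcomp Require Import all_boot all_order all_algebra.
From mathcomp Require Import all_classical all_reals all_analysis.

Set Implicit Arguments.
Unset Strict Implicit.
Unset Printing Implicit Defensive.

Import Order.TTheory GRing.Theory Num.Theory.
Import numFieldNormedType.Exports.

Local Open Scope classical_set_scope.
Local Open Scope ring_scope.

Section intrinsic_volumes.
Context {R : realType}.

Definition box d (a b : 'rV[R]_d) : set 'rV[R]_d :=
  [set x | forall j, a 0 j <= x 0 j <= b 0 j].

(* Lebesgue outer measure on R^d. It is only used on compact sets, where it is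
   Lebesgue measure. The index set I may be empty or finite: in dimension 0
   every box has volume 1, so coverings indexed by all of nat would give the
   one-point space infinite volume. *)
Definition volume d (A : set 'rV[R]_d) : \bar R :=
  ereal_inf [set v | exists (I : set nat) (a b : nat -> 'rV[R]_d),
    [/\ forall i j, a i 0 j <= b i 0 j,
        A `<=` \bigcup_(i in I) box (a i) (b i) &
        v = \esum_(i in I) (\prod_(j < d) (b i 0 j - a i 0 j))%:E]].

(* The norm of 'rV[R]_d in the library is the sup norm, whence the explicit
   Euclidean ball. *)
Definition euclidean_ball d (e : R) : set 'rV[R]_d :=
  [set x | \sum_(j < d) x 0 j ^+ 2 <= e ^+ 2].

Definition parallel_set d (A : set 'rV[R]_d) (e : R) : set 'rV[R]_d :=
  [set x + y | x in A & y in @euclidean_ball d e].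

Definition unit_ball_volume (j : nat) : R := fine (volume (@euclidean_ball j 1)).

Definition polyconvex d (A : set 'rV[R]_d) : Prop :=
  exists (n : nat) (K : 'I_n -> set 'rV[R]_d),
    (forall i, compact (K i) /\ convex_set (K i)) /\ A = \bigcup_i K i.

(* V k is the k-th intrinsic volume: on nonempty compact convex sets it is given
   by the Steiner formula
     vol_d (K + e B^d) = \sum_(k <= d) kappa_(d - k) V_k(K) e^(d - k),
   and it is extended additively to finite unions of compact convex sets.
   These conditions determine V on polyconvex sets; that such an extension
   exists is Groemer's extension theorem. *)
Definition intrinsic_volumes d (V : 'I_d.+1 -> set 'rV[R]_d -> R) : Prop :=
  [/\ forall k, V k set0 = 0,
      forall K : set 'rV[R]_d, compact K -> convex_set K -> K !=set0 ->
        forall e : R, 0 <= e ->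
          volume (parallel_set K e) =
          (\sum_(k < d.+1) unit_ball_volume (d - k) * V k K * e ^+ (d - k))%:E &
      forall k (A B : set 'rV[R]_d), polyconvex A -> polyconvex B ->
        V k (A `|` B) = V k A + V k B - V k (A `&` B)].

End intrinsic_volumes.

Section iid.
Context {R : realType} d (T : measurableType d) (P : probability T R).

Definition mutually_independent d' (T' : measurableType d') (I : choiceType)
    (D : set I) (X : I -> {RV P >-> T'}) : Prop :=
  forall s : seq I, uniq s -> [set` s] `<=` D ->
  forall B : I -> set T', (forall i, measurable (B i)) ->
    P (\bigcap_(i in [set` s]) (X i @^-1` B i)) =
    (\prod_(i <- s) P (X i @^-1` B i))%E.

Definition iid_bernoulli (I : choiceType) (D : set I) (p : R)
    (X : I -> {RV P >-> bool}) : Prop :=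
  (forall i, D i -> forall B : set bool,
     distribution P (X i) B = bernoulli_prob p B) /\
  mutually_independent D X.

End iid.

Section fractal_percolation.
Context {R : realType} (d M : nat).

(* The alphabet Sigma = {1, ..., M^d}: the subcube of side 1/M with index j is
   the one whose lower corner is (j 0, ..., j (d-1)) / M. *)
Definition letter := {ffun 'I_d -> 'I_M}.

Definition unit_cube : set 'rV[R]_d := [set x | forall i, 0 <= x 0 i <= 1].

Definition phi (j : letter) (x : 'rV[R]_d) : 'rV[R]_d :=
  M%:R^-1 *: (x + \row_i (j i)%:R).

Definition cube (s : seq letter) : set 'rV[R]_d :=
  foldr (fun j A => phi j @` A) unit_cube s.

Context disp (T : measurableType disp) (P : probability T R).
Variable Y : seq letter -> {RV P >-> bool}.

Definition retained (w : T) (s : seq letter) : bool :=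
  [forall m : 'I_(size s), Y (take m.+1 s) w].

Definition Flevel (n : nat) (w : T) : set 'rV[R]_d :=
  \bigcup_(s in [set s : n.-tuple letter | retained w s]) cube s.

Definition Ncubes (n : nat) (w : T) : nat :=
  #|[pred s : n.-tuple letter | retained w s]|.

Definition W (n : nat) (w : T) : R :=
  (Ncubes n w)%:R / fine 'E_P[fun w' => (Ncubes n w')%:R].

(* Here and in Z_infty, lim is a total function with value 0 at points where the
   sequence diverges; for p > M^-d these points form a null set. *)
Definition W_infty (w : T) : R := lim (W n w @[n --> \oo]).

Definition Dim (p : R) : R := ln (M%:R ^+ d * p) / ln M%:R.

Variable V : 'I_d.+1 -> set 'rV[R]_d -> R.

Definition Z_infty (p : R) (k : 'I_d.+1) (w : T) : R :=
  lim (M%:R `^ ((k%:R - Dim p) * n%:R) * V k (Flevel n w) @[n --> \oo]).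

Definition Vbar (p : R) (k : 'I_d.+1) : R :=
  lim (M%:R `^ (n%:R * (k%:R - Dim p)) * fine 'E_P[V k \o Flevel n]
       @[n --> \oo]).

End fractal_percolation.

(* Main.v *)
Require Import Defs.
From HB Require Import structures.
From mathcomp Require Import all_boot all_order all_algebra.
From mathcomp Require Import all_classical all_reals all_analysis.
From mathcomp Require Import measurable_realfun ring lra zify.

Set Implicit Arguments.
Unset Strict Implicit.
Unset Printing Implicit Defensive.

Import Order.TTheory GRing.Theory Num.Theory.
Import numFieldNormedType.Exports.

Local Open Scope classical_set_scope.
Local Open Scope ring_scope.

(* Write m = M^d p and let W_n = N_n / m^n be the normalised number of retained
   cubes. All claims follow from the almost sure identity
   Z^k_infty = Vbar_k W_infty together with E W_infty = 1 and
   Var W_infty = (1 - p) / (m - 1).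

   Set X_n = M^(kn) V_k(F_n) / m^n and a_n = E X_n. Splitting F_(n+l) along the
   retained cubes s of level n, additivity of V_k and its homogeneity give
     X_(n+l) = m^-n sum_s X_l^(s) + error,
   where X_l^(s) is the functional of the percolation inside s. The error only
   involves cubes of level n+l meeting the boundary of their ancestor of level n:
   such a cube meets at most 3^d others, and the values of V_k on the cells of
   the grid are bounded by a multiple of M^(-k(n+l)). There are at most
   2d M^((d-1)l) boundary words of length l, so the error has mean O(M^-l); hence
   (a_l) is a Cauchy sequence. Given level n the X_l^(s) are independent with
   mean a_l, so m^-n sum_s (X_l^(s) - a_l) is O(m^(-n/2)) in L^2. Thus
     E |X_(n+l) - a_l W_n| = O(M^-l + m^(-n/2)),
   and with l = n/2 rounded the bounds are summable, which yields almost sure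
   convergence. The same L^2 estimate applied to N_n gives W_infty and, by
   Fatou's lemma, its first two moments. *)

(** * Volume and similarities *)

(** Homogeneity of V_k is read off the Steiner formula: the parallel volume of r K at radius e is
    r^d times that of K at radius e / r, and comparing coefficients of e yields the factor r^k. The
    coefficients carry kappa_(d-k), which must be cancelled, hence must be positive; a lower bound
    for an outer measure defined by coverings is the purpose of the first lemma. In the geometric
    part the obstacle is that inclusion-exclusion over N cubes costs 2^N; the bounds become linear
    in N only because each cell of the grid meets boundedly many others. In the probabilistic part
    no product space is built. Every quantity of finite level depends on finitely many [Y s], so its
    expectation is a finite recursion over coordinates, and independence becomes disjointness of
    sets of coordinates. Of the two final errors one wants l large and the other n large while n + l
    is fixed, whence the balanced choice. Passing from L^2 to L^1 and to the limit uses Young's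
    inequality with a weight of order m^(-n/2). *)

(* Induction on the dimension: for each value t of the last coordinate, the boxes
   lying over t cover a cube of dimension n; integrate the resulting inequality
   over t in [0, 1]. *)
Lemma covering_volume_ge1 (R : realType) (n : nat) (I : pred nat)
    (a b : nat -> nat -> R) :
  (forall i k, a i k <= b i k) ->
  (forall x : nat -> R, (forall k, 0 <= x k <= 1) ->
     exists2 i, I i & forall k, (k < n)%N -> a i k <= x k <= b i k) ->
  (1 <= \sum_(i <oo) ((I i)%:R * \prod_(k < n) (b i k - a i k))%:E)%E.
Proof.
elim: n I => [|n IHn] I leab cover.
  have [i Ii _] := cover (fun=> 0) (fun=> ltac:(by rewrite lexx ler01)).
  rewrite (nneseriesD1 (n := i))// => [|k _]; last first.
    by rewrite lee_fin mulr_ge0// prodr_ge0// => ? _; rewrite subr_ge0.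
  rewrite Ii big_ord0 mulr1 leeDl//; apply: nneseries_ge0 => k _ _.
  by rewrite lee_fin mulr_ge0// prodr_ge0// => ? _; rewrite subr_ge0.
have pos i : 0 <= (I i)%:R * \prod_(k < n) (b i k - a i k).
  by rewrite mulr_ge0// prodr_ge0// => k _; rewrite subr_ge0.
pose f i (t : R) : \bar R :=
  (((I i)%:R * \prod_(k < n) (b i k - a i k))%:E * (\1_`[a i n, b i n] t)%:E)%E.
have IHt t : 0 <= t <= 1 -> (1 <= \sum_(i <oo) f i t)%E.
  move=> t01.
  apply: (le_trans (IHn [pred i | I i && (a i n <= t <= b i n)] leab _)) => /=.
    move=> x x01; have [k|i Ii abi] := cover (fun k => if k == n then t else x k).
      by case: eqP.
    exists i; first by rewrite Ii; have := abi n (ltnSn n); rewrite eqxx.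
    by move=> k kn; have := abi k (ltnW kn); rewrite ltn_eqF.
  rewrite le_eqVlt; apply/orP; left; apply/eqP.
  apply: eq_eseriesr => i _; rewrite /f -EFinM indicE mem_setE in_itv/=.
  by congr EFin; rewrite -mulnb natrM mulrAC.
have mf i : measurable_fun setT (f i).
  apply: measurable_funeM; apply/measurable_EFinP.
  exact: measurable_indic.
have f0 i t : (0 <= f i t)%E by rewrite mule_ge0// lee_fin.
apply: (@le_trans _ _
  (\int[@lebesgue_measure R]_(t in `[0%R, 1%R]) (\sum_(i <oo) f i t))%E).
  have int1 : (1 = \int[@lebesgue_measure R]_(t in `[0%R, 1%R]) (cst 1 t))%E.
    rewrite integral_cst//= lebesgue_measure_itv/= lte_fin ltr01 mul1e.
    by rewrite sube0.
  rewrite [leLHS]int1.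
  apply: ge0_le_integral => //.
  - apply: measurable_funTS.
    rewrite (_ : (fun t => _) = (fun t => \sum_(i <oo | i \in xpredT) f i t)%E).
      by apply: ge0_emeasurable_sum => k; [move=> x _ _; exact: f0|move=> _; exact: mf].
    by apply/funext => t; apply: eq_eseriesl.
rewrite integral_nneseries//; last by move=> i; exact: (measurable_funTS (mf i)).
apply: lee_nneseries => [i _ _|i _]; first by apply: integral_ge0 => t _.
rewrite ge0_integralZl//; last 2 first.
- by apply: measurable_funTS; apply/measurable_EFinP; exact: measurable_indic.
- by rewrite lee_fin.
rewrite integral_indic// big_ord_recr/= mulrA [leRHS]EFinM.
apply: lee_wpmul2l; first by rewrite lee_fin.
apply: (@le_trans _ _ (lebesgue_measure `[a i n, b i n])).
  by apply: le_measure; rewrite ?inE//=; first [exact: measurableI|exact: subIsetl].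
rewrite lebesgue_measure_itv/= lte_fin.
by case: ifPn => // _; rewrite lee_fin subr_ge0.
Qed.

Lemma esum_nneseries (R : realType) (I : set nat) (f : nat -> \bar R) :
  (forall i, (0 <= f i)%E) ->
  \esum_(i in I) f i = (\sum_(i <oo | i \in I) f i)%E.
Proof. by move=> f0; rewrite nneseries_esum// set_mem_set. Qed.

Section volume_similarity.
Context {R : realType} {d : nat}.
Implicit Types (r : R) (A : set 'rV[R]_d) (v : 'rV[R]_d).

(** The translation precedes the scaling, as in [phi], so that [phi j] is literally a similarity of
    ratio 1/M. *)
Definition similarity (r : R) v (x : 'rV[R]_d) : 'rV[R]_d := r *: (x + v).

Lemma similarityK r v : r != 0 -> cancel (similarity r v) (similarity r^-1 (- (r *: v))).
Proof.
by move=> r0 x; rewrite /similarity [r *: (x + v)]scalerDr addrK scalerA mulVf// scale1r.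
Qed.

Lemma similarity_box r v (a b : 'rV[R]_d) : 0 < r ->
  similarity r v @` box a b = box (similarity r v a) (similarity r v b).
Proof.
move=> r0; apply/seteqP; split => [_ [x abx <-] j|x abx].
  by rewrite !mxE !ler_pM2l// !lerD2r; exact: abx.
exists (similarity r^-1 (- (r *: v)) x) => [j|].
  have := abx j; rewrite !mxE ler_pdivlMl// ler_pdivrMl//.
  by rewrite !mulrDr !lerBrDr !lerBlDr.
have := similarityK (- (r *: v)) (invr_neq0 (lt0r_neq0 r0)).
move=> /(_ x); rewrite invrK => {2}<-; congr (similarity _ _ _).
by rewrite scalerN opprK scalerA mulVf ?scale1r// lt0r_neq0.
Qed.

Lemma volume_mono A B : A `<=` B -> (volume A <= volume B)%E.
Proof.
move=> AB; apply: ereal_inf_le_tmp => _ [I [a [b [ab BI ->]]]].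
by exists I, a, b; split => //; apply: subset_trans BI.
Qed.

Lemma volume_box_le (a b : 'rV[R]_d) : (forall j, a 0 j <= b 0 j) ->
  (volume (box a b) <= (\prod_(j < d) (b 0 j - a 0 j))%:E)%E.
Proof.
move=> ab; apply: ereal_inf_lbound; exists [set 0%N], (fun=> a), (fun=> b).
split => //; first by move=> x ?; exists 0%N.
by rewrite esum_set1// lee_fin prodr_ge0// => j _; rewrite subr_ge0.
Qed.

Lemma volume_unit_cube_ge1 : (1 <= volume (@unit_cube R d))%E.
Proof.
apply: le_ereal_inf_tmp => _ [I [a [b [ab cov ->]]]].
(* Vectors become sequences padded with zeros, because the covering lemma varies the dimension by
   induction. *)
pose ext (u : 'rV[R]_d) k := if insub k is Some j then u 0 j else 0.
have extE u (j : 'I_d) : ext u j = u 0 j by rewrite /ext valK.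
apply: le_trans
  (@covering_volume_ge1 R d (fun i => i \in I) (ext \o a) (ext \o b) _ _) _.
- by move=> i k; rewrite /ext/=; case: insubP.
- move=> x x01; have := cov (\row_(j < d) x j).
  case=> [j|i Ii abx]; first by rewrite mxE.
  exists i => [|k kd]; first by rewrite mem_set.
  by have := abx (Ordinal kd); rewrite mxE -!extE.
rewrite esum_nneseries => [|i]; last first.
  by rewrite lee_fin prodr_ge0// => j _; rewrite subr_ge0.
rewrite [leRHS]eseries_mkcond; apply: lee_nneseries => [i _ _|i _].
  rewrite lee_fin mulr_ge0// prodr_ge0// => j _.
  by rewrite subr_ge0 /= !extE.
rewrite (_ : \prod_(k < d) _ = \prod_(j < d) (b i 0 j - a i 0 j)); last first.
  by apply: eq_bigr => j _ /=; rewrite !extE.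
by case: (i \in I); rewrite ?mul1r ?mul0r.
Qed.

Lemma volume_similarity_le r v A : 0 < r ->
  (volume (similarity r v @` A) <= (r ^+ d)%:E * volume A)%E.
Proof.
move=> r0; have rd0 : 0 < r ^+ d by rewrite exprn_gt0.
(* Taking r^d out on both sides leaves a lower bound for an infimum, which can be tested on each
   covering of A. *)
rewrite -[leLHS]mul1e -(mulfV (lt0r_neq0 rd0)) EFinM -muleA.
apply: lee_wpmul2l; first by rewrite lee_fin ltW.
apply: le_ereal_inf_tmp => _ [I [a [b [ab cov ->]]]].
rewrite lee_pdivrMl//; apply: ereal_inf_lbound.
exists I, (fun i => similarity r v (a i)), (fun i => similarity r v (b i)).
split => [i j||].
- by rewrite !mxE ler_pM2l// lerD2r.
- move=> _ [x /cov[i Ii abx] <-]; exists i => //.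
  by rewrite -similarity_box//; exists x.
rewrite !esum_nneseries => [|i|i]; last 2 first.
- by rewrite lee_fin prodr_ge0// => j _; rewrite !mxE subr_ge0 ler_pM2l// lerD2r.
- by rewrite lee_fin prodr_ge0// => j _; rewrite subr_ge0.
rewrite -nneseriesZl; last first.
  by move=> i _; rewrite lee_fin prodr_ge0// => j _; rewrite subr_ge0.
apply: eq_eseriesr => i _; rewrite -EFinM; congr EFin.
rewrite -[X in _ ^+ X](card_ord d) -prodr_const -big_split/=.
by apply: eq_bigr => j _; rewrite !mxE; ring.
Qed.

(** The reverse inequality is [volume_similarity_le] for the inverse similarity, of ratio 1/r. *)
Lemma volume_similarity r v A : 0 < r ->
  volume (similarity r v @` A) = ((r ^+ d)%:E * volume A)%E.
Proof.
move=> r0; apply/le_anti; rewrite volume_similarity_le//=.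
have rd0 : 0 < r ^+ d by rewrite exprn_gt0.
rewrite -lee_pdivlMl// -exprVn.
have ri0 : 0 < r^-1 by rewrite invr_gt0.
apply: le_trans (volume_similarity_le (- (r *: v)) (similarity r v @` A) ri0).
rewrite image_comp (_ : _ \o _ = id) ?image_id//.
by apply/funext => x /=; rewrite similarityK// lt0r_neq0.
Qed.

End volume_similarity.

(** [fine] sends an infinite volume to 0, so finiteness is needed besides a positive lower bound. A
    small cube inside the ball and a cube of side 2 around it provide the two. *)
Lemma unit_ball_volume_gt0 (R : realType) n : 0 < unit_ball_volume n :> R.
Proof.
have lowb : exists2 c : R, 0 < c & (c%:E <= volume (@euclidean_ball R n 1))%E.
  (* In the cube of side r = 1/(n+1) the sum of squares is at most n r <= 1; the successor also
     covers n = 0. *)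
  pose r : R := n.+1%:R^-1.
  have r0 : 0 < r by rewrite invr_gt0.
  exists (r ^+ n); first by rewrite exprn_gt0.
  apply: le_trans (volume_mono (A := similarity r 0 @` @unit_cube R n) _).
    rewrite volume_similarity// -[leLHS]mule1; apply: lee_wpmul2l.
      by rewrite lee_fin ltW// exprn_gt0.
    exact: volume_unit_cube_ge1.
  move=> _ [x x01 <-]; rewrite /euclidean_ball/= expr1n.
  apply: (@le_trans _ _ (\sum_(j < n) r)).
    apply: ler_sum => j _; rewrite !mxE addr0 expr2.
    have /andP[x0 x1] := x01 j.
    have r1 : r <= 1 by rewrite invf_le1 ?ler1n.
    rewrite -[leRHS]mulr1 ler_pM ?mulr_ge0 ?(ltW r0)//.
      by rewrite ler_piMr ?(ltW r0).
    by rewrite -[leRHS]mulr1 ler_pM ?(ltW r0).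
  by rewrite sumr_const card_ord -mulr_natr ler_pdivrMl// mulr1 ler_nat.
have upb : (volume (@euclidean_ball R n 1) < +oo)%E.
  apply: le_lt_trans (volume_mono (B := box (const_mx (- 1)) (const_mx 1)) _) _.
    move=> x; rewrite /euclidean_ball/= expr1n => x1 j; rewrite !mxE.
    rewrite -ler_norml -(@ler_pXn2r _ 2)// ?nnegrE//.
    rewrite expr1n real_normK ?num_real//; apply: le_trans x1.
    by rewrite (bigD1 j)//= lerDl sumr_ge0// => i _; exact: sqr_ge0.
  apply: le_lt_trans (volume_box_le _) _; last by rewrite ltry.
  by move=> j; rewrite !mxE; lra.
case: lowb => c c0 cv; rewrite /unit_ball_volume.
by rewrite fine_gt0// upb andbT; apply: lt_le_trans cv; rewrite lte_fin.
Qed.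

(** * Valuations on a family of convex sets closed under intersection *)

Lemma injective_image_setI (aT rT : Type) (g : aT -> rT) (A B : set aT) :
  injective g -> g @` (A `&` B) = g @` A `&` g @` B.
Proof.
move=> ginj; apply/seteqP; split => [_ [x [Ax Bx] <-]|_ [[x Ax <-] [y By /ginj yx]]].
  by split; exists x.
by exists x => //; split => //; rewrite -yx.
Qed.

Section valuations.
Context {R : realType} {d : nat}.
Implicit Types (A B K : set 'rV[R]_d).

Definition compact_convex K := compact K /\ convex_set K.

Variable v : set 'rV[R]_d -> R.
Hypothesis v0 : v set0 = 0.
Hypothesis vU : forall A B, polyconvex A -> polyconvex B ->
  v (A `|` B) = v A + v B - v (A `&` B).
Variable L : set (set 'rV[R]_d).
Hypothesis LI : forall A B, L A -> L B -> L (A `&` B).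
Hypothesis Lcc : forall K, L K -> compact_convex K.

Lemma polyconvex_bigsetU (I : choiceType) (f : I -> set 'rV[R]_d) (ts : seq I) :
  (forall t, t \in ts -> compact_convex (f t)) ->
  polyconvex (\big[setU/set0]_(t <- ts) f t).
Proof.
move=> cc; exists (size ts), (fun i => f (tnth (in_tuple ts) i)); split.
  by move=> i; apply: cc; exact: mem_tnth.
rewrite -bigcup_seq; apply/seteqP; split => [x [t /= tts ftx]|x [i _ fx]].
  have /tnthP[i ti] : t \in in_tuple ts by [].
  by exists i => //; rewrite -ti.
by exists (tnth (in_tuple ts) i) => //=; exact: mem_tnth.
Qed.

Lemma setI_bigsetU (I : Type) (f : I -> set 'rV[R]_d) (ts : seq I) A :
  A `&` \big[setU/set0]_(t <- ts) f t = \big[setU/set0]_(t <- ts) (A `&` f t).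
Proof.
elim: ts => [|t ts IHts]; first by rewrite !big_nil setI0.
by rewrite !big_cons setIUr IHts.
Qed.

(** One step of inclusion-exclusion. The subtracted term is again a union indexed by [ts], of sets
    [f t] meets; closure of [L] under intersection therefore lets inductions on the list run with
    [f] varying. *)
Lemma valuation_cons (I : choiceType) (f : I -> set 'rV[R]_d) t (ts : seq I) :
  (forall t', t' \in t :: ts -> compact_convex (f t')) ->
  v (\big[setU/set0]_(t' <- t :: ts) f t') =
  v (f t) + v (\big[setU/set0]_(t' <- ts) f t')
  - v (\big[setU/set0]_(t' <- ts) (f t `&` f t')).
Proof.
move=> cc; rewrite big_cons vU ?setI_bigsetU//; last first.
  by apply: polyconvex_bigsetU => t' tts; apply: cc; rewrite inE tts orbT.
have := @polyconvex_bigsetU I f [:: t]; rewrite big_seq1; apply => t'.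
by rewrite inE => /eqP ->; apply/cc/mem_head.
Qed.

(* Inclusion-exclusion: both intersection terms in the induction step are
   unions of one set fewer, whence the factor 2 per set. *)
Lemma valuation_bound (c : R) (I : choiceType) (f : I -> set 'rV[R]_d) (ts : seq I) :
  (forall K, L K -> `|v K| <= c) ->
  (forall t, t \in ts -> L (f t)) ->
  `|v (\big[setU/set0]_(t <- ts) f t)| <= (2 ^+ size ts - 1) * c.
Proof.
move=> vc; elim: ts f => [|t ts IHts] f Lf.
  by rewrite big_nil v0 normr0 expr0 subrr mul0r.
rewrite valuation_cons => [|t' tts]; last exact/Lcc/Lf.
rewrite exprS.
have Lfts t' : t' \in ts -> L (f t') by move=> tts; apply: Lf; rewrite inE tts orbT.
have b1 := vc _ (Lf t (mem_head _ _)).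
have b2 := IHts f Lfts.
have b3 := IHts (fun t' => f t `&` f t')
  (fun t' tts => LI (Lf t (mem_head _ _)) (Lfts _ tts)).
apply: le_trans (ler_normB _ _) _; apply: le_trans (lerD (ler_normD _ _) b3) _.
by apply: le_trans (lerD (lerD b1 b2) (lexx _)) _; lra.
Qed.

(** Members of [L] scale by hypothesis. Inclusion-exclusion carries this over to unions, because an
    injective [g] commutes with intersections and these stay in [L]. *)
Lemma valuation_image (r : R) (g : 'rV[R]_d -> 'rV[R]_d) (I : choiceType)
    (f : I -> set 'rV[R]_d) (ts : seq I) :
  injective g ->
  (forall K, L K -> compact_convex (g @` K) /\ v (g @` K) = r * v K) ->
  (forall t, t \in ts -> L (f t)) ->
  v (\big[setU/set0]_(t <- ts) (g @` f t)) = r * v (\big[setU/set0]_(t <- ts) f t).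
Proof.
move=> ginj vg; elim: ts f => [|t ts IHts] f Lf.
  by rewrite !big_nil v0 mulr0.
rewrite !valuation_cons => [|t' tts|t' tts].
- have Lfts t' : t' \in ts -> L (f t').
    by move=> tts; apply: Lf; rewrite inE tts orbT.
  rewrite (vg _ (Lf t (mem_head _ _))).2 IHts//.
  under [X in _ - v X]eq_bigr do rewrite -injective_image_setI//.
  rewrite (IHts (fun t' => f t `&` f t')) => [|t' tts]; first by ring.
  by apply: LI; [apply/Lf/mem_head|exact: Lfts].
- exact/Lcc/Lf.
- by have [] := vg _ (Lf _ tts).
Qed.

(** * Unions in which every set meets few others *)

Section overlaps.
Context {I : choiceType} (f : I -> set 'rV[R]_d) (c : R) (N : nat).
Hypothesis vc : forall K, L K -> `|v K| <= c.
Hypothesis Lf : forall t, L (f t).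

Definition overlapping t t' := f t `&` f t' != set0.

(** The bound is asked of every index and not only of members of [ts], so it passes to sublists and
    applies to a set about to be added. *)
Definition few_overlaps (ts : seq I) := forall t, (count (overlapping t) ts <= N)%N.

Let C := 2 ^+ N * c.

Lemma bound_ge0 (t : I) : 0 <= c.
Proof. exact: le_trans (vc (Lf t)). Qed.

Lemma bigsetU_overlapping t ts :
  \big[setU/set0]_(t' <- ts) (f t `&` f t') =
  \big[setU/set0]_(t' <- [seq t' <- ts | overlapping t t']) (f t `&` f t').
Proof.
rewrite big_filter [RHS]big_mkcond; apply: eq_bigr => t' _.
by case: ifPn => //; rewrite negbK => /eqP.
Qed.

(** Empty intersections drop out of the union, so the exponential bound of [valuation_bound] is paid
    for at most [N] sets, whatever the length of [ts]. *)
Lemma overlap_bound t ts : few_overlaps ts ->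
  `|v (\big[setU/set0]_(t' <- ts) (f t `&` f t'))| <= C.
Proof.
move=> few; rewrite bigsetU_overlapping.
apply: le_trans (valuation_bound vc (fun t' _ => LI (Lf t) (Lf t'))) _.
apply: ler_wpM2r; first exact: bound_ge0 t.
rewrite size_filter lerBlDr; apply: le_trans (_ : 2 ^+ N <= _); last by rewrite lerDl.
by rewrite ler_weXn2l// ler1n.
Qed.

(** Adding one set changes the value by at most its own value plus its overlap term, that is by c +
    C <= 2 C. *)
Lemma valuation_size_bound ts : few_overlaps ts ->
  `|v (\big[setU/set0]_(t <- ts) f t)| <= 2 * C * (size ts)%:R.
Proof.
elim: ts => [|t ts IHts] few; first by rewrite big_nil v0 normr0 mulr0.
have few' : few_overlaps ts.
  by move=> t'; apply: leq_trans (few t'); rewrite /= leq_addl.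
rewrite valuation_cons => [|t' _]; last exact/Lcc.
apply: le_trans (ler_normB _ _) _.
apply: le_trans (lerD (ler_normD _ _) (overlap_bound t few')) _.
apply: le_trans (lerD (lerD (vc (Lf t)) (IHts few')) (lexx _)) _.
have cC : c <= C by rewrite /C ler_peMl ?(bound_ge0 t)// exprn_ege1// ler1n.
by rewrite /= -natr1; lra.
Qed.

(** Prepending [t] to [ts1] alters the error by the difference of two overlap terms of [t], with
    [ts1 ++ ts2] and with [ts1]. They agree when [t] misses all of [ts2], as it does outside [bd];
    otherwise each is at most C. *)
Lemma valuation_cat (bd : pred I) ts1 ts2 : few_overlaps (ts1 ++ ts2) ->
  (forall t t', t \in ts1 -> t' \in ts2 -> overlapping t t' -> bd t) ->
  `|v (\big[setU/set0]_(t <- ts1 ++ ts2) f t)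
    - v (\big[setU/set0]_(t <- ts1) f t)
    - v (\big[setU/set0]_(t <- ts2) f t)| <= 2 * C * (count bd ts1)%:R.
Proof.
elim: ts1 => [|t ts1 IHts1] few mbd.
  by rewrite cat0s big_nil v0 subr0 subrr normr0 mulr0.
have few' : few_overlaps (ts1 ++ ts2).
  by move=> t'; apply: leq_trans (few t'); rewrite /= leq_addl.
have few1 : few_overlaps ts1.
  by move=> t'; apply: leq_trans (few' t'); rewrite count_cat leq_addr.
have {}IHts1 : `|v (\big[setU/set0]_(t <- ts1 ++ ts2) f t)
    - v (\big[setU/set0]_(t <- ts1) f t)
    - v (\big[setU/set0]_(t <- ts2) f t)| <= 2 * C * (count bd ts1)%:R.
  by apply: IHts1 => // t1 t2 t1ts; apply: mbd; rewrite inE t1ts orbT.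
rewrite cat_cons !valuation_cons; try by move=> *; exact: Lcc.
rewrite /= natrD mulrDr.
set a := v (f t); set u12 := v _ in IHts1 *; set u1 := v _ in IHts1 *.
set u2 := v _ in IHts1 *; set o12 := v _; set o1 := v _.
have -> : a + u12 - o12 - (a + u1 - o1) - u2 = (u12 - u1 - u2) + (o1 - o12).
  by ring.
apply: le_trans (ler_normD _ _) _; rewrite addrC; apply: lerD => //.
have [bdt|nbdt] := boolP (bd t).
  rewrite mulr1 mulr2n mulrDl mul1r; apply: le_trans (ler_normB _ _) _.
  by apply: lerD; exact: overlap_bound.
suff -> : o12 = o1 by rewrite subrr normr0 mulr0.
rewrite /o12 /o1 big_cat/= [X in _ `|` X]big1_seq ?setU0// => t' /= t'ts.
apply/eqP; apply: contraNT nbdt => mt; apply: mbd mt => //; exact: mem_head.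
Qed.

(** Blocks are split off one at a time by [valuation_cat]. Only [bd] members can touch another
    block, so only they are counted in the error. *)
Lemma valuation_flatten (bd : pred I) (J : eqType) (F : J -> seq I) (ss : seq J) :
  few_overlaps (flatten (map F ss)) -> uniq ss ->
  (forall s s' t t', s \in ss -> s' \in ss -> s != s' ->
     t \in F s -> t' \in F s' -> overlapping t t' -> bd t) ->
  `|v (\big[setU/set0]_(t <- flatten (map F ss)) f t)
    - \sum_(s <- ss) v (\big[setU/set0]_(t <- F s) f t)| <=
  2 * C * \sum_(s <- ss) (count bd (F s))%:R.
Proof.
elim: ss => [|s ss IHss] /= few ssuniq mbd.
  by rewrite !big_nil v0 subrr normr0 mulr0.
case/andP: ssuniq => sss ssuniq; rewrite !(big_cons _ _ s) mulrDr.
have few' : few_overlaps (flatten (map F ss)).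
  by move=> t; apply: leq_trans (few t); rewrite count_cat leq_addl.
have := @valuation_cat bd _ _ few; have := IHss few' ssuniq
  (fun s1 s2 t t' s1s s2s => mbd s1 s2 t t' (mem_behead (s := s :: ss) s1s)
    (mem_behead (s := s :: ss) s2s)).
set u := v _; set w := v _; set x := v _; move=> h1 h2.
have -> : w - (x + \sum_(s <- ss) v (\big[setU/set0]_(t <- F s) f t)) =
   (w - x - u) + (u - \sum_(s <- ss) v (\big[setU/set0]_(t <- F s) f t)) by ring.
apply: le_trans (ler_normD _ _) _; apply: lerD => //; apply: h2 => t t' ts.
move=> /flattenP[_ /mapP[s' s'ss ->] t's']; apply: (mbd s s') => //.
- exact: mem_head.
- by rewrite inE s'ss orbT.
- by apply: contraNneq sss => ->.
Qed.

End overlaps.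

End valuations.

(** * Scaling of intrinsic volumes *)

Section intrinsic_similarity.
Context {R : realType} {d : nat}.
Implicit Types (A K : set 'rV[R]_d).

Lemma parallel_similarity (r e : R) u A : 0 < r ->
  parallel_set (similarity r u @` A) e = similarity r u @` parallel_set A (r^-1 * e).
Proof.
move=> r0; have r0' := lt0r_neq0 r0; apply/seteqP; split.
- move=> _ [_ [x Ax <-] [y ye <-]]; exists (x + r^-1 *: y).
    exists x => //; exists (r^-1 *: y) => //; rewrite /euclidean_ball/=.
    under eq_bigr do rewrite !mxE exprMn.
    by rewrite -mulr_sumr exprMn ler_wpM2l// exprn_ge0// invr_ge0 ltW.
  by rewrite /similarity addrAC scalerDr scalerA mulfV// scale1r.
- move=> _ [_ [x Ax [y ye <-]] <-]; exists (similarity r u x); first by exists x.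
  exists (r *: y).
    rewrite /euclidean_ball/=; under eq_bigr do rewrite !mxE exprMn.
    move: ye; rewrite /euclidean_ball/= exprMn => ye.
    by rewrite -mulr_sumr -ler_pdivlMl ?exprn_gt0// -exprVn.
  by rewrite /similarity addrAC [RHS]scalerDr.
Qed.

Lemma polynomial_coef_inj (a b : 'I_d.+1 -> R) :
  (forall e : R, 0 <= e -> \sum_(k < d.+1) a k * e ^+ (d - k) =
                           \sum_(k < d.+1) b k * e ^+ (d - k)) -> a =1 b.
Proof.
move=> ab k.
pose q := \poly_(i < d.+1) (a (inord (d - i)) - b (inord (d - i))).
have qE e : 0 <= e -> q.[e] = 0.
  move=> e0; rewrite horner_poly (reindex_inj rev_ord_inj)/=.
  under eq_bigr => i _.
    rewrite subSS subKn ?leq_ord// inord_val mulrBl.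
    over.
  by rewrite sumrB ab// subrr.
have q0 : q = 0.
  (* Equality is known for nonnegative e only; the integers 0, ..., size q - 1 lie there and are
     more numerous than the degree. *)
  apply: (@roots_geq_poly_eq0 _ _ [seq i%:R | i <- iota 0 (size q)]).
  - by apply/allP => _ /mapP[i _ ->]; rewrite rootE qE.
  - by rewrite map_inj_uniq ?iota_uniq//; exact: mulrIn (oner_neq0 _).
  - by rewrite size_map size_iota.
have := coef_poly d.+1 (fun i => a (inord (d - i)) - b (inord (d - i))) (d - k).
rewrite -/q q0 coef0 ltnS leq_subr subKn ?leq_ord// inord_val.
by move/esym/eqP; rewrite subr_eq0 => /eqP.
Qed.

(** Compare the Steiner polynomial of the image at e with r^d times that of K at e / r: since r^d (e
    / r)^(d-k) = r^k e^(d-k), the coefficients differ by r^k, and kappa_(d-k) > 0 cancels. *)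
Lemma intrinsic_similarity (V : 'I_d.+1 -> set 'rV[R]_d -> R) (r : R) u K k :
  intrinsic_volumes V -> 0 < r -> compact_convex K -> K !=set0 ->
  compact_convex (similarity r u @` K) ->
  V k (similarity r u @` K) = r ^+ k * V k K.
Proof.
move=> [_ steiner _] r0 [cK vK] K0 [crK vrK].
have r0' := lt0r_neq0 r0.
have rK0 : similarity r u @` K !=set0 by case: K0 => x Kx; exists (similarity r u x), x.
have := @polynomial_coef_inj
  (fun k => unit_ball_volume (d - k) * V k (similarity r u @` K))
  (fun k => unit_ball_volume (d - k) * (r ^+ k * V k K)) _ k.
have /mulfI kinj : unit_ball_volume (d - k) != 0 :> R.
  by rewrite gt_eqF// unit_ball_volume_gt0.
move=> h; apply: kinj; apply: h => e e0; apply: EFin_inj; rewrite -steiner// parallel_similarity//.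
rewrite volume_similarity// steiner//; last by rewrite mulr_ge0// invr_ge0 ltW.
rewrite -EFinM mulr_sumr; congr EFin; apply: eq_bigr => i _.
rewrite exprMn exprVn.
have -> : r ^+ d = r ^+ i * r ^+ (d - i) by rewrite -exprD subnKC// leq_ord.
have : r ^+ (d - i) != 0 by rewrite expf_neq0.
by move=> ?; field.
Qed.

Lemma box_compact_convex (a b : 'rV[R]_d) : compact_convex (box a b).
Proof.
split; last first.
  move=> x y l /set_mem xab /set_mem yab; apply/mem_set => j.
  have /andP[ax xb] := xab j; have /andP[ay yb] := yab j.
  have l0 : 0 <= l%:num by []. have l1 : l%:num <= 1 by [].
  rewrite /conv/= !mxE /unstable.onem.
  by apply/andP; split; nra.
have := @rV_compact R d (fun j => `[a 0 j, b 0 j]%classic)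
  (fun j => @segment_compact R _ _).
by congr compact.
Qed.
End intrinsic_similarity.

(** * Words and grid positions *)

Section words.
Context {d M : nat}.
Notation letter := (letter d M).
Implicit Types (s t : seq letter).

Fixpoint words n : seq (seq letter) :=
  if n is n'.+1 then [seq j :: s | j <- enum {: letter}, s <- words n'] else [:: [::]].

Lemma mem_words n s : (s \in words n) = (size s == n).
Proof.
elim: n s => [|n IHn] [|j s] //=.
  by apply/negbTE/negP => /allpairsP[[j s] []].
rewrite eqSS -IHn; apply/allpairsP/idP => [[[j' s'] [_ s'n [_ ->]]]//|sn].
by exists (j, s); rewrite mem_enum.
Qed.

Lemma words_uniq n : uniq (words n).
Proof.
elim: n => //= n IHn; apply: allpairs_uniq => //; first exact: enum_uniq.
by move=> [j s] [j' s'] _ _ [-> ->].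
Qed.

Lemma words_cat n l : words (n + l) = [seq s ++ t | s <- words n, t <- words l].
Proof.
elim: n => [|n IHn] /=; first by rewrite cats0 map_id.
rewrite IHn; elim: (enum _) => //= j js ->.
rewrite allpairs_cat; congr (_ ++ _).
rewrite map_flatten -map_comp allpairs_mapl; congr flatten.
by apply: eq_map => s /=; rewrite -map_comp.
Qed.

Lemma size_words n : size (words n) = ((M ^ d) ^ n)%N.
Proof.
elim: n => //= n IHn.
by rewrite size_allpairs IHn -cardE card_ffun !card_ord expnS.
Qed.

(** The letters are base-M digits, most significant first: this is coordinate i of the lower corner
    of [cube s] in units of the side length M^-(size s). *)
Fixpoint zpos s (i : 'I_d) : nat :=
  if s is j :: s' then (j i * M ^ size s' + zpos s' i)%N else 0%N.

Lemma zpos_lt s i : (zpos s i < M ^ size s)%N.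
Proof.
elim: s => //= j s IHs; rewrite expnS.
apply: leq_trans (_ : (j i).+1 * M ^ size s <= _)%N; last by rewrite leq_mul2r ltn_ord orbT.
by rewrite mulSn addnC ltn_add2r.
Qed.

Lemma zpos_cat s t i : zpos (s ++ t) i = (zpos s i * M ^ size t + zpos t i)%N.
Proof.
elim: s => //= j s ->; rewrite size_cat expnD mulnDl mulnA.
by rewrite addnA.
Qed.

Lemma zpos_inj s t : size s = size t -> zpos s =1 zpos t -> s = t.
Proof.
elim: s t => [|j s IHs] [|j' t] //= [st] zst.
have Mgt0 (i : 'I_d) : (0 < M ^ size t)%N by rewrite expn_gt0 (leq_ltn_trans _ (ltn_ord (j i))).
have zs i : (zpos s i < M ^ size t)%N by rewrite -st zpos_lt.
congr (_ :: _); last first.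
  apply: IHs => // i; have := zst i; rewrite /= st => /(congr1 (fun x => x %% M ^ size t)%N).
  by rewrite !modnMDl !modn_small ?zpos_lt// zs.
apply/ffunP => i; apply: val_inj => /=.
have := zst i; rewrite /= st => /(congr1 (fun x => x %/ M ^ size t)%N).
by rewrite !(divnMDl _ _ (Mgt0 i)) (divn_small (zs i)) divn_small ?addn0 ?zpos_lt.
Qed.

(** In each direction the positions run from 0 to M^(size t) - 1; the extreme ones are those of
    cubes touching a face of the unit cube. *)
Definition on_boundary t :=
  [exists i : 'I_d, (zpos t i == 0%N) || (zpos t i == (M ^ size t).-1)].

(** The combinatorial counterpart of two closed cubes of the same level meeting; a word is its own
    neighbour. *)
Definition neighbours s t :=
  [forall i, (zpos s i <= (zpos t i).+1)%N && (zpos t i <= (zpos s i).+1)%N].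

(** In a direction where the ancestors sit at x < y, the positions x m + a and y m + b with a, b < m
    can differ by at most 1 only if a = m - 1. With x > y the same argument forces a = 0. *)
Lemma neighbours_on_boundary s s' t t' : size s = size s' -> size t = size t' ->
  s != s' -> neighbours (s ++ t) (s' ++ t') -> on_boundary t.
Proof.
move=> ss' tt' nss' /forallP adj.
have [i zi] : exists i, zpos s i != zpos s' i.
  apply/existsP; apply: contraR nss' => /existsPn h; apply/eqP/zpos_inj => // i.
  by apply/eqP; rewrite -[_ == _]negbK h.
apply/existsP; exists i; have := adj i; rewrite !zpos_cat -tt'.
have := zpos_lt t i; have := zpos_lt t' i; rewrite -tt'.
move: (zpos t i) (zpos t' i) (M ^ _)%N (zpos s i) (zpos s' i) zi => a b m x y.
move=> /eqP xy bm am /andP[h1 h2].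
have [xley|yltx] := ltnP x y.
  have : (x.+1 * m <= y * m)%N by rewrite leq_mul2r xley orbT.
  by rewrite mulSn => h; apply/orP; right; apply/eqP; lia.
have : (y.+1 * m <= x * m)%N by rewrite leq_mul2r orbC; apply/orP; left; lia.
by rewrite mulSn => h; apply/orP; left; apply/eqP; lia.
Qed.

Lemma count_neighbours n t (ts : seq (seq letter)) : uniq ts -> size t = n ->
  (forall s, s \in ts -> size s = n) -> (count (neighbours t) ts <= 3 ^ d)%N.
Proof.
(* A neighbour is determined by its offset from [t], which lies in {-1, 0, 1} in each direction; the
   successor shifts it to {0, 1, 2}. *)
move=> tsu tn tsn; pose g s := [ffun i => inord ((zpos s i).+1 - zpos t i) : 'I_3].
rewrite -size_filter -(size_map g).
have ginj : {in [seq s <- ts | neighbours t s] &, injective g}.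
  move=> s s'; rewrite !mem_filter => /andP[/forallP ts_s sts] /andP[/forallP ts_s' s'ts].
  move=> gss'; apply: zpos_inj; first by rewrite !tsn.
  move=> i; have := ts_s i; have := ts_s' i; move/ffunP : gss' => /(_ i).
  rewrite !ffunE => /(congr1 val); move=> + /andP[h1 h2] /andP[h3 h4].
  by rewrite /= !inordK; lia.
have gu : uniq (map g [seq s <- ts | neighbours t s]).
  by rewrite map_inj_in_uniq// filter_uniq.
by rewrite -(card_uniqP gu); apply: leq_trans (max_card _) _; rewrite card_ffun !card_ord.
Qed.

Lemma count_letter (i : 'I_d) (c : nat) :
  (count (fun j : letter => j i == c :> nat) (enum {: letter}) <= M ^ d.-1)%N.
Proof.
have [cM|] := ltnP c M; last first.
  move=> Mc; rewrite (@eq_count _ _ pred0) ?count_pred0// => j /=.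
  by apply/negbTE; rewrite neq_ltn (leq_trans (ltn_ord _) Mc).
pose F k := if k == i then pred1 (Ordinal cM) else predT.
have /eq_count-> : (fun j : letter => j i == c :> nat) =1 mem (family F).
  move=> j; apply/eqP/familyP => [jc k|/(_ i)]; last first.
    by rewrite /F eqxx inE => /eqP ->.
  by rewrite /F; case: eqP => [->|_]; rewrite inE//; apply/eqP/val_inj.
have <- : #|family F| = count (mem (family F)) (enum {: letter}).
  by rewrite cardE enumT -size_filter.
rewrite card_family.
rewrite foldrE big_map big_enum/= (bigD1 i)//= /F eqxx card1 mul1n.
under eq_bigr => k ki do rewrite (negbTE ki) card_ord.
by rewrite prod_nat_const cardC1 card_ord.
Qed.

(** The first letter must have i-th digit c / M^n and the remaining word must sit at c mod M^n, so
    the count is at most a product; each of the n letters retains d - 1 free digits. *)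
Lemma count_zpos n (i : 'I_d) (c : nat) :
  (count (fun s => zpos s i == c) (words n) <= (M ^ d.-1) ^ n)%N.
Proof.
elim: n c => [|n IHn] c; first by rewrite /= addn0; case: eqP.
rewrite -sum1_count big_mkcond big_allpairs_dep/=.
pose p (j : letter) : nat := j i == (c %/ M ^ n)%N :> nat.
pose q s : nat := zpos s i == (c %% M ^ n)%N.
apply: (@leq_trans (\sum_(j <- enum {: letter}) \sum_(s <- words n) p j * q s)%N).
  apply: leq_sum => j _; rewrite big_seq [leqRHS]big_seq; apply: leq_sum => s.
  rewrite mem_words => /eqP sn; rewrite /p /q sn; case: ifP => // /eqP <-.
  have zn : (zpos s i < M ^ n)%N by rewrite -sn zpos_lt.
  by rewrite divnMDl ?(leq_ltn_trans _ zn)// divn_small// addn0 modnMDl modn_small// !eqxx.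
under eq_bigr => j _ do rewrite -big_distrr.
rewrite -big_distrl expnS; apply: leq_mul.
  by apply: leq_trans (count_letter i (c %/ M ^ n)); rewrite -sum1_count [leqRHS]big_mkcond.
by apply: leq_trans (IHn (c %% M ^ n)%N); rewrite -sum1_count [leqRHS]big_mkcond.
Qed.

Lemma count_on_boundary n :
  (count on_boundary (words n) <= 2 * d * (M ^ d.-1) ^ n)%N.
Proof.
rewrite -sum1_count big_mkcond.
apply: (@leq_trans (\sum_(s <- words n) \sum_(i < d)
   ((zpos s i == 0) + (zpos s i == (M ^ n).-1)))%N).
  rewrite big_seq [leqRHS]big_seq; apply: leq_sum => s.
  rewrite mem_words => /eqP sn; case: ifP => // /existsP[i]; rewrite sn => zi.
  by rewrite (bigD1 i)//= -addnA; case/orP: zi => /eqP ->; rewrite eqxx// addnC.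
rewrite exchange_big/=; under eq_bigr do rewrite big_split.
apply: leq_trans (_ : \sum_(i < d) 2 * (M ^ d.-1) ^ n <= _)%N.
  apply: leq_sum => i _; rewrite mul2n -addnn; apply: leq_add.
    by apply: leq_trans (count_zpos n i 0%N); rewrite -sum1_count [leqRHS]big_mkcond.
  by apply: leq_trans (count_zpos n i (M ^ n).-1); rewrite -sum1_count [leqRHS]big_mkcond.
by rewrite sum_nat_const card_ord mulnA (mulnC d).
Qed.

End words.

(** * Cells of a cubical grid *)

Section grid.
Context {R : realType} {d : nat}.
Implicit Types (delta : R) (K : set 'rV[R]_d) (z : 'I_d -> nat) (S : {set 'I_d}).

Definition corner z : 'rV[R]_d := \row_i (z i)%:R.

(** [S] is the set of directions in which the face extends: all directions give the unit cube, none
    the origin. *)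
Definition face S : set 'rV[R]_d := box 0 (\row_i (i \in S)%:R).

Definition grid_cell (delta : R) z S := similarity delta (corner z) @` face S.

(* The cells of all dimensions of the cubical grid of mesh [delta], with the
   empty set added so that the family is closed under intersection. *)
Definition grid_cells (delta : R) : set (set 'rV[R]_d) :=
  [set K | K = set0 \/ exists z S, K = grid_cell delta z S].

Lemma grid_cellE delta z S : 0 < delta ->
  grid_cell delta z S = box (\row_i (delta * (z i)%:R)) (\row_i (delta * (z i + (i \in S))%:R)).
Proof.
move=> d0; rewrite /grid_cell /face similarity_box//.
by congr box; apply/rowP => i; rewrite !mxE ?add0r// natrD addrC.
Qed.

Lemma compact_convex0 : compact_convex (set0 : set 'rV[R]_d).
Proof.
split; first exact: compact0.
by move=> x y l /set_mem.
Qed.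

Lemma grid_cells_compact_convex delta K : 0 < delta ->
  grid_cells delta K -> compact_convex K.
Proof.
move=> d0 [->|[z [S ->]]]; first exact: compact_convex0.
by rewrite grid_cellE//; exact: box_compact_convex.
Qed.

(** In each direction the cells are grid intervals of length 0 or 1 mesh, and two such intervals
    meet in nothing, in a grid point or in a whole mesh interval. *)
Lemma grid_cells_setI delta K K' : 0 < delta ->
  grid_cells delta K -> grid_cells delta K' -> grid_cells delta (K `&` K').
Proof.
move=> d0 [->|[z [S ->]]]; first by rewrite set0I; left.
case=> [->|[z' [S' ->]]]; first by rewrite setI0; left.
pose lo i := maxn (z i) (z' i).
pose hi i := minn (z i + (i \in S)) (z' i + (i \in S')).
have IE : grid_cell delta z S `&` grid_cell delta z' S' =
    box (\row_i (delta * (lo i)%:R)) (\row_i (delta * (hi i)%:R)).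
  rewrite !grid_cellE//; apply/seteqP; split => [x [h h'] i|x h].
    have := h i; have := h' i; rewrite !mxE => /andP[a1 a2] /andP[a3 a4].
    by rewrite /lo /hi /maxn /minn; apply/andP; split; case: ifP.
  split => i; have := h i; rewrite !mxE => /andP[a1 a2]; apply/andP; split.
  - by apply: le_trans a1; rewrite ler_pM2l// ler_nat leq_maxl.
  - by apply: le_trans a2 _; rewrite ler_pM2l// ler_nat geq_minl.
  - by apply: le_trans a1; rewrite ler_pM2l// ler_nat leq_maxr.
  - by apply: le_trans a2 _; rewrite ler_pM2l// ler_nat geq_minr.
rewrite IE; have [/forallP lohi|/forallPn[i]] := boolP [forall i, lo i <= hi i]%N.
  right; exists lo, (finset (fun i => lo i < hi i)%N); rewrite grid_cellE//; congr box.
  apply/rowP => i; rewrite !mxE inE; congr (_ * _%:R).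
  have := lohi i; rewrite /lo /hi /maxn /minn.
  by case: (i \in S); case: (i \in S'); do !case: ifP; lia.
rewrite -ltnNge => hilo; left; apply/seteqP; split => // x /(_ i).
rewrite !mxE => /andP[a1 a2]; have := le_trans a1 a2.
by rewrite ler_pM2l// ler_nat leqNgt hilo.
Qed.

Lemma similarity_comp (r s : R) u w (x : 'rV[R]_d) : s != 0 ->
  similarity r u (similarity s w x) = similarity (r * s) (w + s^-1 *: u) x.
Proof.
move=> s0; rewrite /similarity -scalerA; congr (_ *: _).
by rewrite !scalerDr scalerA mulfV// scale1r addrA.
Qed.

Lemma grid_cell_similarity (M n l : nat) u z S : (0 < M)%N ->
  similarity (M%:R^-1 ^+ n) (corner u) @` grid_cell (M%:R^-1 ^+ l) z S =
  grid_cell (M%:R^-1 ^+ (n + l)) (fun i => u i * M ^ l + z i)%N S.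
Proof.
move=> M0; have M0' : M%:R != 0 :> R by rewrite pnatr_eq0 -lt0n.
rewrite /grid_cell image_comp; congr image; apply/funext => x /=.
rewrite similarity_comp ?expf_neq0 ?invr_eq0// exprD; congr similarity.
by apply/rowP => i; rewrite !mxE exprVn invrK natrD natrM natrX addrC mulrC.
Qed.

Lemma face_nonempty S : face S !=set0.
Proof. by exists 0 => i; rewrite !mxE lexx/=. Qed.

Section functional.
Variables (V : 'I_d.+1 -> set 'rV[R]_d -> R) (k : 'I_d.+1).
Hypothesis Vint : intrinsic_volumes V.

(** There are only 2^d faces, and the sum dominates each of them; through homogeneity it controls
    V_k on every cell of every mesh. *)
Definition face_bound : R := \sum_(S : {set 'I_d}) `|V k (face S)|.

Lemma intrinsic_grid_cell delta z S : 0 < delta ->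
  V k (grid_cell delta z S) = delta ^+ k * V k (face S).
Proof.
move=> d0; apply: intrinsic_similarity => //; first exact: box_compact_convex.
- exact: face_nonempty.
- by apply: (grid_cells_compact_convex d0); right; exists z, S.
Qed.

Lemma intrinsic_grid_cells_bound delta K : 0 < delta -> grid_cells delta K ->
  `|V k K| <= delta ^+ k * face_bound.
Proof.
move=> d0; have dk : 0 <= delta ^+ k by rewrite exprn_ge0// ltW.
case=> [->|[z [S ->]]].
  by have [-> _ _] := Vint; rewrite normr0 mulr_ge0// sumr_ge0.
rewrite intrinsic_grid_cell// normrM ger0_norm// ler_wpM2l//.
by rewrite /face_bound (bigD1 S)//= lerDl sumr_ge0.
Qed.

End functional.
End grid.

(** * Intrinsic volumes of the construction steps *)

Section percolation_functional.
Context {R : realType} {d M : nat}.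
Notation letter := (letter d M).
Implicit Types (s t : seq letter) (y : seq letter -> bool).
Hypothesis M0 : (0 < M)%N.

Lemma cube_cat s t : cube (s ++ t) =
  similarity (M%:R^-1 ^+ size s) (corner (zpos s)) @` (cube t : set 'rV[R]_d).
Proof.
have M0' : M%:R != 0 :> R by rewrite pnatr_eq0 -lt0n.
rewrite /cube foldr_cat; elim: s => [|j s IHs] /=.
  rewrite (_ : similarity _ _ = id) ?image_id//; apply/funext => x.
  by rewrite /similarity expr0 scale1r; apply/rowP => i; rewrite !mxE addr0.
rewrite IHs image_comp; congr image; apply/funext => x /=.
rewrite -[phi _ _]/(similarity M%:R^-1 (\row_i (j i)%:R) _).
rewrite similarity_comp ?expf_neq0 ?invr_eq0// -exprS; congr similarity.
by apply/rowP => i; rewrite !mxE exprVn invrK natrD natrM natrX addrC mulrC.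
Qed.

Lemma cube_grid_cell s :
  cube s = grid_cell (M%:R^-1 ^+ size s) (zpos s) (finset predT) :> set 'rV[R]_d.
Proof.
rewrite -[s in LHS]cats0 cube_cat /grid_cell; congr image.
by apply/seteqP; split => x h i; have := h i; rewrite !mxE inE.
Qed.

Lemma cubes_neighbours s t : size s = size t ->
  (cube s `&` cube t : set 'rV[R]_d) != set0 -> neighbours s t.
Proof.
move=> st /set0P[x []]; rewrite !cube_grid_cell.
have rpos : 0 < M%:R^-1 ^+ size t :> R by rewrite exprn_gt0// invr_gt0 ltr0n.
rewrite !grid_cellE ?st// => h1 h2; apply/forallP => i.
have := h1 i; have := h2 i; rewrite !mxE !inE !addn1 => /andP[a1 a2] /andP[a3 a4].
have := le_trans a1 a4; have := le_trans a3 a2.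
by rewrite !ler_pM2l// !ler_nat => -> ->.
Qed.

(** [retained] for a fixed configuration [y], which keeps the geometric estimates deterministic. *)
Definition survives y s : bool := [forall m : 'I_(size s), y (take m.+1 s)].

(** The configuration governing the percolation inside the cube of [s], rescaled to the unit
    cube. *)
Definition subtree s y : seq letter -> bool := fun t => y (s ++ t).

Lemma survives_cat y s t : survives y (s ++ t) = survives y s && survives (subtree s y) t.
Proof.
apply/forallP/andP => [h|[/forallP h1 /forallP h2]].
  split; apply/forallP => m.
    have ms : (m < size (s ++ t))%N by rewrite size_cat ltn_addr.
    have := h (Ordinal ms); rewrite /= take_cat ltn_neqAle ltn_ord andbT.
    by case: eqP => //= ->; rewrite subnn take0 cats0 take_oversize.
  have ms : (size s + m < size (s ++ t))%N by rewrite size_cat ltn_add2l.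
  have := h (Ordinal ms); rewrite /= take_cat ltnNge leqW ?leq_addr//=.
  by rewrite -addnS addKn.
move=> [m /=]; rewrite size_cat => ms; rewrite take_cat.
case: ltnP => [ms1|]; first by have := h1 (Ordinal (ltnW ms1)).
rewrite leq_eqVlt => /orP[/eqP sm|].
  rewrite -sm subnn take0 cats0.
  have ms1 : (m < size s)%N by rewrite sm.
  by have := h1 (Ordinal ms1); rewrite /= -sm take_size.
rewrite ltnS => sm; have mt : (m - size s < size t)%N by rewrite ltn_subLR.
by have := h2 (Ordinal mt); rewrite subSn.
Qed.

Definition survivors n y := [seq s <- words n | survives y s].

Lemma mem_survivors n y s : (s \in survivors n y) = survives y s && (size s == n).
Proof. by rewrite mem_filter mem_words. Qed.

Lemma survivors_cat n l y : survivors (n + l) y =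
  flatten [seq [seq s ++ t | t <- survivors l (subtree s y)] | s <- survivors n y].
Proof.
rewrite /survivors words_cat filter_flatten -map_comp.
elim: (words n) => //= s ss ->; rewrite filter_map.
rewrite (eq_filter (a2 := fun t => survives y s && survives (subtree s y) t)) => [|t]; last first.
  exact: survives_cat.
by case: (survives y s) => //=; rewrite filter_pred0.
Qed.

Definition retained_union n y : set 'rV[R]_d :=
  \big[setU/set0]_(s <- survivors n y) cube s.

Lemma retained_unionE n y : retained_union n y =
  \bigcup_(s in [set s : n.-tuple letter | survives y s]) cube s.
Proof.
rewrite /retained_union -bigcup_seq; apply/seteqP; split => x [s /=].
  rewrite mem_survivors => /andP[rs sn] sx.
  by exists (Tuple sn).
by move=> rs sx; exists s => //=; rewrite mem_survivors rs size_tuple eqxx.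
Qed.

Variables (V : 'I_d.+1 -> set 'rV[R]_d -> R) (k : 'I_d.+1).
Hypothesis Vint : intrinsic_volumes V.

(** The factor M^(kn) compensates the size of the cubes of level n, so each of them contributes a
    bounded amount. Division by m^n is left to [normalize], which keeps this part free of p. *)
Definition vol_k n y : R := M%:R ^+ (k * n) * V k (retained_union n y).

(** At most 3^d cubes of a level meet a given one, which makes 2^(3^d) the cost of
    inclusion-exclusion; the outer 2 is that of [valuation_size_bound] and [valuation_cat]. *)
Let C : R := 2 * (2 ^+ (3 ^ d) * face_bound V k).

(* Truncating [cube] to one level makes every member a cell of the same mesh. *)
Let f n s : set 'rV[R]_d := if size s == n then cube s else set0.

Let delta n : R := M%:R^-1 ^+ n.

Let delta_gt0 n : 0 < delta n.
Proof. by rewrite exprn_gt0// invr_gt0 ltr0n. Qed.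

Let f_cells n s : grid_cells (delta n) (f n s).
Proof.
rewrite /f; case: eqP => [<-|_]; last by left.
by right; exists (zpos s), (finset predT); exact: cube_grid_cell.
Qed.

Let f_few n ss : uniq ss -> (forall s, s \in ss -> size s = n) ->
  few_overlaps (f n) (3 ^ d) ss.
Proof.
move=> ssu ssn t; have [tn|tn] := eqVneq (size t) n; last first.
  rewrite (@eq_in_count _ _ pred0) ?count_pred0// => s _ /=.
  by rewrite /overlapping /f (negbTE tn) set0I eqxx.
apply: leq_trans (count_neighbours ssu tn ssn).
rewrite -!sum1_count big_mkcond [leqRHS]big_mkcond big_seq [leqRHS]big_seq.
apply: leq_sum => s sss; rewrite /overlapping /f tn ssn// !eqxx.
by case: ifP => // /cubes_neighbours->//; rewrite tn ssn.
Qed.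

Let retained_unionf n y :
  retained_union n y = \big[setU/set0]_(s <- survivors n y) f n s.
Proof.
apply: eq_big_seq => s; rewrite mem_survivors => /andP[_ sn].
by rewrite /f sn.
Qed.

Let scaled n (x B : R) : `|x| <= 2 * (2 ^+ (3 ^ d) * (delta n ^+ k * face_bound V k)) * B ->
  `|M%:R ^+ (k * n) * x| <= C * B.
Proof.
move=> xB; rewrite normrM ger0_norm//.
have Mk : 0 < M%:R ^+ (k * n) :> R by rewrite exprn_gt0// ltr0n.
rewrite -ler_pdivlMl//; apply: le_trans xB _.
have -> : delta n ^+ k = (M%:R ^+ (k * n))^-1 by rewrite /delta exprVn exprVn -exprM mulnC.
rewrite /C le_eqVlt; apply/orP; left; apply/eqP.
by field; rewrite gt_eqF.
Qed.

Lemma vol_k_bound n y : `|vol_k n y| <= C * (size (survivors n y))%:R.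
Proof.
have [v0 _ vU] := Vint.
apply: scaled; rewrite retained_unionf.
apply: (valuation_size_bound (v0 k) (vU k)
  (fun A B => @grid_cells_setI _ _ _ A B (delta_gt0 n))
  (fun K => @grid_cells_compact_convex _ _ _ K (delta_gt0 n))
  (fun K => @intrinsic_grid_cells_bound _ _ V k Vint _ K (delta_gt0 n))
  (f_cells n)).
apply: f_few => [|s]; first by rewrite filter_uniq// words_uniq.
by rewrite mem_survivors => /andP[_ /eqP].
Qed.

(** The cubes [s ++ t] form a copy of the subtree's cubes shrunk by M^-n. Homogeneity gives the
    factor M^(-kn), which the normalisation at level n + l absorbs. *)
Lemma vol_k_subtree n l s y : size s = n ->
  vol_k l (subtree s y) = M%:R ^+ (k * (n + l)) *
    V k (\big[setU/set0]_(t <- survivors l (subtree s y)) cube (s ++ t)).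
Proof.
move=> sn; have [v0 _ vU] := Vint.
under eq_bigr do rewrite cube_cat.
rewrite sn.
rewrite (@valuation_image _ _ (V k) (v0 k) (vU k) (grid_cells (delta l)) _ _ (delta n ^+ k)).
- have -> : delta n ^+ k = (M%:R ^+ (k * n))^-1 by rewrite /delta exprVn exprVn -exprM mulnC.
  have Mkn : M%:R ^+ (k * n) != 0 :> R by rewrite expf_neq0// pnatr_eq0 -lt0n.
  by rewrite /vol_k /retained_union mulnDr exprD; field.
- by move=> A B; exact: grid_cells_setI.
- by move=> K; exact: grid_cells_compact_convex.
- apply: can_inj (@similarityK _ _ _ _ _); exact: lt0r_neq0 (delta_gt0 n).
- move=> K [->|[z [S ->]]].
    by rewrite image_set0 !v0 mulr0; split => //; exact: compact_convex0.
  rewrite /delta grid_cell_similarity//; split.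
    apply: (grid_cells_compact_convex (delta_gt0 (n + l))).
    by right; do 2 eexists.
  rewrite !intrinsic_grid_cell//; try exact: delta_gt0.
  by rewrite exprD exprMn mulrA.
- move=> t; rewrite mem_survivors => /andP[_ /eqP <-].
  by right; exists (zpos t), (finset predT); exact: cube_grid_cell.
Qed.

Lemma vol_k_branch n l y :
  `|vol_k (n + l) y - \sum_(s <- survivors n y) vol_k l (subtree s y)| <=
  C * \sum_(s <- survivors n y) (count (@on_boundary d M) (survivors l (subtree s y)))%:R.
Proof.
have [v0 _ vU] := Vint.
(* [valuation_flatten] takes a single predicate on full words; [drop n] recovers the part below the
   ancestor. *)
rewrite [X in _ * X](_ : _ = \sum_(s <- survivors n y)
    (count (@on_boundary d M \o drop n)
      [seq s ++ t | t <- survivors l (subtree s y)])%:R); last first.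
  apply: eq_big_seq => s; rewrite mem_survivors => /andP[_ /eqP sn].
  by rewrite count_map; congr _%:R; apply: eq_count => t /=; rewrite -sn drop_size_cat.
rewrite [X in _ - X](_ : _ = M%:R ^+ (k * (n + l)) * \sum_(s <- survivors n y)
    V k (\big[setU/set0]_(t <- [seq s ++ t | t <- survivors l (subtree s y)]) f (n + l) t)).
  rewrite /vol_k -mulrBr; apply: scaled; rewrite retained_unionf survivors_cat.
  apply: (valuation_flatten (v0 k) (vU k)
    (fun A B => @grid_cells_setI _ _ _ A B (delta_gt0 (n + l)))
    (fun K => @grid_cells_compact_convex _ _ _ K (delta_gt0 (n + l)))
    (fun K => @intrinsic_grid_cells_bound _ _ V k Vint _ K (delta_gt0 (n + l)))
    (f_cells (n + l))).
  - rewrite -survivors_cat; apply: f_few => [|s]; first by rewrite filter_uniq// words_uniq.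
    by rewrite mem_survivors => /andP[_ /eqP].
  - by rewrite filter_uniq// words_uniq.
  - move=> s s' _ _ + + nss' /mapP[t + ->] /mapP[t' + ->] /=.
    rewrite !mem_survivors => /andP[_ /eqP sn] /andP[_ /eqP s'n].
    move=> /andP[_ /eqP tl] /andP[_ /eqP t'l].
    rewrite /overlapping /f !size_cat sn s'n tl t'l eqxx => st.
    rewrite -sn drop_size_cat//; apply: (@neighbours_on_boundary _ _ s s' t t') nss' _.
    - by rewrite sn s'n.
    - by rewrite tl t'l.
    - by apply: cubes_neighbours st; rewrite !size_cat sn s'n tl t'l.
rewrite mulr_sumr; apply: eq_big_seq => s; rewrite mem_survivors => /andP[_ /eqP sn].
rewrite (vol_k_subtree _ _ sn) big_map; congr (_ * V k _).
apply: eq_big_seq => t; rewrite mem_survivors => /andP[_ /eqP tl].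
by rewrite /f size_cat sn tl eqxx.
Qed.

End percolation_functional.

(** * Fields of independent Bernoulli variables *)

Section bernoulli_field.
Context {R : realType} {disp : measure_display} {T : measurableType disp}.
Variable P : probability T R.
Context {I : choiceType} (Y : I -> {RV P >-> bool}) (D : set I) (p : R).
Hypothesis p01 : 0 <= p <= 1.
Hypothesis Y_iid : iid_bernoulli D p Y.
Implicit Types (y : I -> bool) (u : seq I) (g : (I -> bool) -> R).

Definition field (w : T) : I -> bool := fun i => Y i w.

Definition depends_on (A : Type) u (g : (I -> bool) -> A) :=
  forall y y', {in u, y =1 y'} -> g y = g y'.

Definition update x b y : I -> bool := fun i => if i == x then b else y i.

Lemma depends_on_update (A : Type) x b u (g : (I -> bool) -> A) :
  depends_on (x :: u) g -> depends_on u (g \o update x b).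
Proof.
move=> gu y y' yy' /=; apply: gu => i; rewrite inE /update.
by case: eqP => //= _; exact: yy'.
Qed.

Lemma depends_on_split x u g y : depends_on (x :: u) g ->
  g y = if y x then g (update x true y) else g (update x false y).
Proof.
by move=> gu; case: ifP => yx; apply: gu => i _; rewrite /update; case: eqP => [->|].
Qed.

Lemma measurable_field u g : depends_on u g -> measurable_fun setT (g \o field).
Proof.
elim: u g => [|x u IHu] g gu.
  rewrite (_ : g \o field = cst (g (fun=> false))); first exact: measurable_cst.
  by apply/funext => w; exact: gu.
rewrite (_ : g \o field = fun w => if Y x w then (g \o update x true) (field w)
   else (g \o update x false) (field w)); last first.
  by apply/funext => w; exact: depends_on_split gu.
apply: measurable_fun_ifT => //=.
- exact: IHu _ (depends_on_update true gu).
- exact: IHu _ (depends_on_update false gu).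
Qed.

Lemma bounded_depends_on u g : depends_on u g -> exists c, forall y, `|g y| <= c.
Proof.
elim: u g => [|x u IHu] g gu.
  by exists `|g (fun=> false)| => y; rewrite (gu y (fun=> false)).
have [c1 h1] := IHu _ (depends_on_update true gu).
have [c2 h2] := IHu _ (depends_on_update false gu).
exists (Num.max c1 c2) => y; rewrite (depends_on_split y gu) le_max.
by case: ifP => _; rewrite ?h1 ?h2 ?orbT.
Qed.

Lemma bounded_Lfun1 (X : T -> R) c : measurable_fun setT X ->
  (forall w, `|X w| <= c) -> X \in Lfun P 1.
Proof.
move=> mX Xc; apply/Lfun1_integrable/measurable_bounded_integrable => //.
  by rewrite [X in (X < _)%E](probability_setT P) ltry.
by exists c; split; rewrite ?num_real// => r cr w _; exact: le_trans (ltW cr).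
Qed.

Lemma depends_on_Lfun u g : depends_on u g -> g \o field \in Lfun P 1.
Proof.
move=> gu; have [c gc] := bounded_depends_on gu.
by apply: (@bounded_Lfun1 _ c) => [|w]; [exact: measurable_field gu|exact: gc].
Qed.

(** Expectation by conditioning on one coordinate after another. Once all coordinates that [g] uses
    are fixed, [g] is constant, and evaluating it at the all-false configuration is legitimate. *)
Fixpoint mean u g : R :=
  if u is x :: u' then
    p * mean u' (g \o update x true) + (1 - p) * mean u' (g \o update x false)
  else g (fun=> false).

Definition cylinder u y (w : T) : R := \prod_(i <- u) (Y i w == y i)%:R.

Lemma cylinder_indic u y :
  cylinder u y = \1_(\bigcap_(i in [set` u]) (Y i @^-1` [set y i])).
Proof.
apply/funext => w; rewrite /cylinder indicE.
have [h|h] := pselect ((\bigcap_(i in [set` u]) (Y i @^-1` [set y i])) w).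
  by rewrite mem_set// big1_seq// => i /andP[_ iu]; rewrite (h i iu) eqxx.
rewrite memNset//; apply/eqP; rewrite prodf_seq_eq0; apply/hasP.
move: h => /existsNP[i /not_implyP[iu /eqP yi]]; exists i => //=.
by rewrite (negbTE yi) eqxx.
Qed.

Lemma cylinder_Lfun u y : cylinder u y \in Lfun P 1.
Proof.
apply: (@depends_on_Lfun u (fun y' => \prod_(i <- u) (y' i == y i)%:R)).
by move=> y1 y2 y12; apply: eq_big_seq => i iu; rewrite y12.
Qed.

Lemma expectation_cylinder u y : uniq u -> [set` u] `<=` D ->
  'E_P[cylinder u y]%E = (\prod_(i <- u) (if y i then p else 1 - p))%:E.
Proof.
move=> uu uD; have [distrY indepY] := Y_iid.
rewrite cylinder_indic expectation_indic; last first.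
  apply: fin_bigcap_measurable => // i _.
  by rewrite -[X in measurable X]setTI; apply: measurable_funPT.
rewrite (indepY u uu uD (fun i => [set y i]))// big_seq.
rewrite [in RHS]big_seq -prodEFin; apply: eq_bigr => i iu.
transitivity (distribution P (Y i) [set y i]) => //.
rewrite distrY; last exact: uD.
by rewrite /bernoulli_prob p01 fsbig_set1 /bernoulli_pmf.
Qed.

(** The cylinder carries the coordinates already conditioned upon; each induction step moves one
    coordinate from [u] to [v]. The case of empty [v] identifies expectation with [mean]. *)
Lemma expectation_cylinder_mul u v g y : depends_on u g ->
  uniq (u ++ v) -> [set` u ++ v] `<=` D ->
  'E_P[cylinder v y \* (g \o field)]%E =
  ((\prod_(i <- v) (if y i then p else 1 - p)) * mean u g)%:E.
Proof.
elim: u v g y => [|x u IHu] v g y gu uv uvD /=.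
  rewrite (_ : _ \* _ = g (fun=> false) \o* cylinder v y); last first.
    by apply/funext => w /=; congr (_ * _); exact: gu.
  by rewrite expectationZl ?cylinder_Lfun// expectation_cylinder// EFinM muleC.
have xv : x \notin v by move: uv; rewrite /= mem_cat negb_or -andbA => /and3P[].
have cylE b w : cylinder (x :: v) (update x b y) w = (Y x w == b)%:R * cylinder v y w.
  rewrite /cylinder big_cons {1}/update eqxx; congr (_ * _).
  apply: eq_big_seq => i iv; have ix : i != x by apply: contraNneq xv => <-.
  by rewrite /update (negbTE ix).
rewrite (_ : _ \* _ =
    (cylinder (x :: v) (update x true y) \* ((g \o update x true) \o field)) \+
    (cylinder (x :: v) (update x false y) \* ((g \o update x false) \o field))); last first.
  apply/funext => w /=; rewrite !cylE (depends_on_split (field w) gu) /field.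
  by case: (Y x w) => /=; rewrite ?mul1r ?mul0r ?addr0 ?add0r.
have uvperm : perm_eq ((x :: u) ++ v) (u ++ x :: v).
  by rewrite perm_sym (perm_catCA u [:: x] v).
have uv' : uniq (u ++ x :: v) by rewrite -(perm_uniq uvperm).
have uvD' : [set` u ++ x :: v] `<=` D.
  by move=> i /= iuv; apply: uvD; rewrite /= (perm_mem uvperm).
have cylmul b : cylinder (x :: v) (update x b y) \* ((g \o update x b) \o field)
    \in Lfun P 1.
  apply: (@depends_on_Lfun (u ++ x :: v) (fun y' =>
    (\prod_(i <- x :: v) (y' i == update x b y i)%:R) * g (update x b y'))).
  move=> y1 y2 y12; congr (_ * _).
    by apply: eq_big_seq => i iu; rewrite y12// mem_cat iu orbT.
  by apply: (depends_on_update b gu) => i iu; rewrite y12// mem_cat iu.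
rewrite expectationD// !IHu//; try exact: depends_on_update.
rewrite -EFinD; congr EFin; rewrite !big_cons /update eqxx.
have vE b : \prod_(j <- v) (if if j == x then b else y j then p else 1 - p) =
    \prod_(j <- v) (if y j then p else 1 - p).
  apply: eq_big_seq => i iv; have ix : i != x by apply: contraNneq xv => <-.
  by rewrite (negbTE ix).
by rewrite !vE; ring.
Qed.

Definition expect g : R := fine 'E_P[g \o field]%E.

(** The finite support is hidden and only a set [E] containing it is recorded: finiteness gives
    measurability and boundedness, disjointness of such sets gives independence. *)
Definition depends (A : Type) (E : set I) (g : (I -> bool) -> A) :=
  exists u, [/\ uniq u, [set` u] `<=` E & depends_on u g].

Lemma expectation_mean u g : depends_on u g -> uniq u -> [set` u] `<=` D ->
  'E_P[g \o field]%E = (mean u g)%:E.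
Proof.
move=> gu uu uD.
have := @expectation_cylinder_mul u [::] g (fun=> false) gu.
rewrite cats0 big_nil mul1r => <- //; congr expectation; apply/funext => w /=.
by rewrite /cylinder big_nil mul1r.
Qed.

Lemma expect_mean u g : depends_on u g -> uniq u -> [set` u] `<=` D ->
  expect g = mean u g.
Proof. by move=> gu uu uD; rewrite /expect (expectation_mean gu). Qed.

Lemma depends_Lfun g E : depends E g -> g \o field \in Lfun P 1.
Proof. by case=> u [_ _ /depends_on_Lfun]. Qed.

Lemma expectE g : depends D g -> 'E_P[g \o field]%E = (expect g)%:E.
Proof. by case=> u [uu uD gu]; rewrite /expect (expectation_mean gu). Qed.

Lemma mean_indep u u' g h : depends_on u g -> depends_on u' h -> uniq (u ++ u') ->
  mean (u ++ u') (g \* h) = mean u g * mean u' h.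
Proof.
have meanZ c v k : mean v (fun y => c * k y) = c * mean v k.
  elim: v k => //= x v IHv k; rewrite mulrDr 2!(mulrCA c) -!IHv.
  by [].
elim: u g h => [|x u IHu] g h gu hu uu /=.
  rewrite -meanZ; congr mean; apply/funext => y /=; congr (_ * _); exact: gu.
have [xu uu'] : x \notin u' /\ uniq (u ++ u').
  by move: uu; rewrite /= mem_cat negb_or -andbA => /and3P[].
have hx b : h \o update x b = h.
  apply/funext => y; apply: hu => i iu'; rewrite /update; case: eqP => // ix.
  by rewrite ix (negbTE xu) in iu'.
have mE b : mean (u ++ u') ((g \* h) \o update x b) = mean u (g \o update x b) * mean u' h.
  rewrite -IHu//; last exact: depends_on_update.
  by congr mean; rewrite -[in RHS](hx b).
by rewrite !mE; ring.
Qed.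

Lemma expect_indep (E1 E2 : set I) g h : depends E1 g -> depends E2 h ->
  E1 `<=` D -> E2 `<=` D -> E1 `&` E2 = set0 ->
  expect (g \* h) = expect g * expect h.
Proof.
move=> [u [uu uE1 gu]] [v [vv vE2 hv]] E1D E2D E120.
have uvuniq : uniq (u ++ v).
  rewrite cat_uniq uu vv andbT; apply/hasPn => i iv; apply/negP => iu.
  by have : set0 i by rewrite -E120; split; [exact: uE1|exact: vE2].
rewrite (@expect_mean (u ++ v)) ?mean_indep//.
- rewrite (expect_mean gu)//; last exact: subset_trans E1D.
  by rewrite (expect_mean hv)//; exact: subset_trans E2D.
- move=> y1 y2 y12 /=; congr (_ * _); [apply: gu|apply: hv] => i iu.
    by apply: y12; rewrite mem_cat iu.
  by apply: y12; rewrite mem_cat iu orbT.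
- by move=> i /=; rewrite mem_cat => /orP[/uE1/E1D|/vE2/E2D].
Qed.

Lemma depends_reindex (A : Type) (E1 E2 : set I) (f : I -> I) (g : (I -> bool) -> A) :
  injective f -> f @` E1 `<=` E2 -> depends E1 g -> depends E2 (fun y => g (y \o f)).
Proof.
move=> finj fE [u [uu uE1 gu]]; exists (map f u); split.
- by rewrite map_inj_uniq.
- by move=> _ /mapP[i iu ->]; apply: fE; exists i => //; exact: uE1.
- by move=> y y' yy'; apply: gu => i iu /=; apply: yy'; exact: map_f.
Qed.

(** An injectively relabelled i.i.d. field has the same law. With [f] prefixing a word, this makes
    the percolation inside a cube a copy of the whole. *)
Lemma expect_reindex (f : I -> I) g : injective f -> f @` D `<=` D -> depends D g ->
  expect (fun y => g (y \o f)) = expect g.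
Proof.
move=> finj fD [u [uu uD gu]].
have meanf v h : mean (map f v) (fun y => h (y \o f)) = mean v h.
  elim: v h => //= x v IHv h.
  by congr (_ * _ + _ * _); rewrite -IHv; congr mean; apply/funext => y /=;
    congr h; apply/funext => i /=; rewrite /update (inj_eq finj).
rewrite (expect_mean gu)// (@expect_mean (map f u)).
- exact: meanf.
- by move=> y y' yy'; apply: gu => i iu /=; apply: yy'; exact: map_f.
- by rewrite map_inj_uniq.
- by move=> _ /mapP[i iu ->]; apply: fD; exists i => //; exact: uD.
Qed.

Lemma depends_mono (A : Type) (E1 E2 : set I) (g : (I -> bool) -> A) :
  E1 `<=` E2 -> depends E1 g -> depends E2 g.
Proof. by move=> E12 [u [uu uE gu]]; exists u; split => //; exact: subset_trans E12. Qed.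

Lemma depends_pair (A B C : Type) (E : set I) (h : A -> B -> C)
    (g1 : (I -> bool) -> A) (g2 : (I -> bool) -> B) :
  depends E g1 -> depends E g2 -> depends E (fun y => h (g1 y) (g2 y)).
Proof.
move=> [u [uu uE gu]] [v [vv vE gv]]; exists (undup (u ++ v)); split.
- exact: undup_uniq.
- by move=> i /=; rewrite mem_undup mem_cat => /orP[/uE|/vE].
- move=> y y' yy'; congr h; [apply: gu|apply: gv] => i iu; apply: yy';
  by rewrite mem_undup mem_cat iu ?orbT.
Qed.

Lemma depends_comp (A B : Type) (E : set I) (h : A -> B) (g : (I -> bool) -> A) :
  depends E g -> depends E (h \o g).
Proof. by move=> [u [uu uE gu]]; exists u; split => // y y' /gu /= ->. Qed.

Lemma depends_cst (A : Type) (E : set I) (a : A) : depends E (fun=> a).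
Proof. by exists [::]. Qed.

Lemma depends_map (J : eqType) (B : Type) (E : set I) (js : seq J)
    (g : J -> (I -> bool) -> B) :
  (forall j, j \in js -> depends E (g j)) ->
  depends E (fun y => map (fun j => g j y) js).
Proof.
elim: js => [|j js IHjs] gE; first exact: depends_cst.
apply: (@depends_pair _ _ _ E cons); first exact/gE/mem_head.
by apply: IHjs => i ijs; apply: gE; rewrite inE ijs orbT.
Qed.

Lemma depends_coord (E : set I) i : E i -> depends E (fun y => y i).
Proof.
move=> Ei; exists [:: i]; split => //; first by move=> j /=; rewrite inE => /eqP ->.
by move=> y y' yy'; apply: yy'; rewrite mem_head.
Qed.

Lemma expectD g h : depends D g -> depends D h -> expect (g \+ h) = expect g + expect h.
Proof.
move=> gD hD; apply: EFin_inj; rewrite EFinD -!expectE//; last exact: depends_pair.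
by rewrite -expectationD ?(depends_Lfun gD) ?(depends_Lfun hD).
Qed.

Lemma expectZ c g : depends D g -> expect (fun y => c * g y) = c * expect g.
Proof.
move=> gD; apply: EFin_inj; rewrite EFinM -!expectE//; last first.
  exact: (depends_comp (fun x => c * x)).
rewrite -expectationZl ?(depends_Lfun gD)//; congr expectation.
by apply/funext => w /=; rewrite mulrC.
Qed.

Lemma expect_cst c : expect (fun=> c) = c.
Proof. by rewrite /expect expectation_cst. Qed.

Lemma expect_sum (J : eqType) (js : seq J) (g : J -> (I -> bool) -> R) :
  (forall j, j \in js -> depends D (g j)) ->
  expect (fun y => \sum_(j <- js) g j y) = \sum_(j <- js) expect (g j).
Proof.
elim: js => [|j js IHjs] gD.
  rewrite big_nil -[RHS](expect_cst 0); congr expect; apply/funext => y.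
  by rewrite big_nil.
have gD' i : i \in js -> depends D (g i) by move=> ijs; apply: gD; rewrite inE ijs orbT.
rewrite big_cons -IHjs// -expectD; first last.
- have := depends_comp (fun s => \sum_(x <- s) x) (depends_map gD').
  by congr depends; apply/funext => y /=; rewrite big_map.
- exact/gD/mem_head.
by congr expect; apply/funext => y; rewrite big_cons.
Qed.

Lemma expect_le g h : depends D g -> depends D h -> (forall y, g y <= h y) ->
  expect g <= expect h.
Proof.
move=> gD hD gh; rewrite -subr_ge0 -[- expect g]mulN1r -expectZ// addrC.
rewrite -expectD//; last exact: (depends_comp (fun x => -1 * x)).
rewrite -lee_fin -expectE; last exact: (depends_pair (fun a b => -1 * a + b)).
by apply: expectation_ge0 => w /=; rewrite mulN1r addrC subr_ge0.
Qed.

Lemma expect_coord i : D i -> expect (fun y => (y i)%:R) = p.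
Proof.
move=> Di; rewrite (@expect_mean [:: i])//=.
- by rewrite /update eqxx /= mulr1 mulr0 addr0.
- by move=> y y' yy'; rewrite yy'// mem_head.
- by move=> j /=; rewrite inE => /eqP ->.
Qed.

End bernoulli_field.

(** * Moments of branching sums *)

Section branching.
Context {R : realType} {disp : measure_display} {T : measurableType disp}.
Variable P : probability T R.
Context {d M : nat} (Y : seq (letter d M) -> {RV P >-> bool}) (p : R).
Notation letter := (letter d M).
Let D : set (seq letter) := [set s | s <> [::]].
Hypothesis p01 : 0 <= p <= 1.
Hypothesis Y_iid : iid_bernoulli D p Y.
Implicit Types (s t : seq letter) (y : seq letter -> bool) (g : (seq letter -> bool) -> R).

Notation Ex := (expect Y).

(** The word [s] itself is excluded: [Y s] decides whether its cube survives, while the percolation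
    inside uses proper descendants only. *)
Definition below s : set (seq letter) := [set t | exists2 a, a <> [::] & t = s ++ a].

Definition off s : set (seq letter) := D `\` below s.

Definition up_to n : set (seq letter) := [set t | t <> [::] /\ (size t <= n)%N].

Lemma below_D s : below s `<=` D.
Proof. by move=> _ [a a0 ->]; case: s. Qed.

Lemma up_to_off s : up_to (size s) `<=` off s.
Proof.
move=> t [t0 ts]; split => // -[a a0 ta]; move: ts; rewrite ta size_cat.
by rewrite -{2}[size s]addn0 leq_add2l leqn0 size_eq0 => /eqP.
Qed.

Lemma below_off s t : size s = size t -> s != t -> below t `<=` off s.
Proof.
move=> st nst x xt; split; first exact: below_D xt.
case: xt => [a a0 ->] [b b0 /eqP]; rewrite eqseq_cat// => /andP[/eqP ts _].
by rewrite ts eqxx in nst.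
Qed.

Lemma depends_survives n s : (size s <= n)%N -> depends (up_to n) (fun y => survives y s).
Proof.
move=> sn; exists (undup [seq take m.+1 s | m <- iota 0 (size s)]); split.
- exact: undup_uniq.
- move=> t /=; rewrite mem_undup => /mapP[m]; rewrite mem_iota => /= ms ->.
  split; first by case: (s) ms.
  by rewrite size_take; case: ifP => // _; exact: leq_trans sn.
- move=> y y' yy'; rewrite /survives; apply: eq_forallb => m; apply: yy'.
  by rewrite mem_undup; apply/mapP; exists (val m) => //; rewrite mem_iota /=.
Qed.

Lemma depends_survivors n : depends (up_to n) (@survivors d M n).
Proof.
have : depends (up_to n)
    (fun y => mask (map (fun s => survives y s) (@words d M n)) (@words d M n)).
  apply: (depends_comp (fun b => mask b (@words d M n))).
  by apply: depends_map => s; rewrite mem_words => /eqP sn; apply: depends_survives; rewrite sn.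
by congr depends; apply/funext => y; rewrite -filter_mask.
Qed.

Lemma up_to_D n : up_to n `<=` D.
Proof. by move=> t []. Qed.

Lemma depends_subtree (A : Type) s (g : (seq letter -> bool) -> A) :
  depends D g -> depends (below s) (fun y => g (subtree s y)).
Proof.
move=> gD; apply: (depends_reindex (f := cat s)) gD.
  by move=> a b /eqP; rewrite eqseq_cat// eqxx => /eqP.
by move=> _ [a a0 <-]; exists a.
Qed.

Lemma expect_subtree s g : depends D g -> Ex (fun y => g (subtree s y)) = Ex g.
Proof.
move=> gD; apply: (expect_reindex p01 Y_iid (f := cat s)) gD.
  by move=> a b /eqP; rewrite eqseq_cat// eqxx => /eqP.
by move=> _ [a a0 <-]; case: s.
Qed.

(** The branching property: what is decided off [s], including the survival of [s] and the
    percolation in other cubes of its level, is independent of the copy inside [s]. *)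
Lemma expect_off_mul s h g : depends (off s) h -> depends D g ->
  Ex (fun y => h y * g (subtree s y)) = Ex h * Ex g.
Proof.
move=> hs gD; rewrite -(expect_subtree s gD).
apply: (expect_indep p01 Y_iid hs (depends_subtree s gD)).
- by move=> t [].
- exact: below_D.
- by apply/seteqP; split => // t [[_ nst] st].
Qed.

Lemma depends_survives_real n s : (size s <= n)%N ->
  depends (up_to n) (fun y => (survives y s)%:R : R).
Proof. by move=> sn; exact: (depends_comp (fun b : bool => b%:R : R) (depends_survives sn)). Qed.

Lemma expect_survives s : Ex (fun y => (survives y s)%:R) = p ^+ size s.
Proof.
elim: s => [|j s IHs].
  rewrite -[RHS](expect_cst Y 1); congr expect; apply/funext => y.
  by rewrite (_ : survives y [::])//; apply/forallP => -[].
rewrite exprS -IHs -(expect_coord p01 Y_iid (i := [:: j]))//.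
rewrite -(expect_off_mul (s := [:: j])).
- congr expect; apply/funext => y.
  rewrite -[j :: s]/([:: j] ++ s) survives_cat -mulnb natrM; congr (_%:R * _).
  congr nat_of_bool; apply/forallP/idP => [/(_ ord0)//|yj m].
  by rewrite ord1.
- apply: (depends_comp (fun b : bool => b%:R : R)).
  by apply: depends_coord; apply: (@up_to_off [:: j]).
- exact: depends_mono (@up_to_D (size s)) (depends_survives_real (leqnn _)).
Qed.

Lemma expect_sqr_sum (J : eqType) (js : seq J) (X : J -> (seq letter -> bool) -> R) :
  uniq js -> (forall j, j \in js -> depends D (X j)) ->
  (forall i j, i \in js -> j \in js -> i != j -> Ex (fun y => X i y * X j y) = 0) ->
  Ex (fun y => (\sum_(j <- js) X j y) ^+ 2) = \sum_(j <- js) Ex (fun y => X j y ^+ 2).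
Proof.
move=> jsu XD X0; under eq_fun do rewrite expr2 mulr_suml.
have XXD i j : i \in js -> j \in js -> depends D (fun y => X i y * X j y).
  by move=> /XD iD /XD jD; exact: depends_pair.
have -> : (fun y => \sum_(i <- js) X i y * (\sum_(j <- js) X j y)) =
          (fun y => \sum_(i <- js) \sum_(j <- js) X i y * X j y).
  by apply/funext => y; apply: eq_bigr => i _; rewrite mulr_sumr.
rewrite (expect_sum p01 Y_iid); last first.
  move=> i ijs; have := depends_comp (fun r : seq R => \sum_(x <- r) x)
    (depends_map (js := js) (fun j => XXD i j ijs)).
  by congr depends; apply/funext => y /=; rewrite big_map.
apply: eq_big_seq => i ijs; rewrite (expect_sum p01 Y_iid); last by move=> j; exact: XXD.
rewrite (bigD1_seq i)//= big1_seq ?addr0; last first.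
  by move=> j /andP[ji jjs]; rewrite X0// eq_sym.
by congr expect; apply/funext => y; rewrite expr2.
Qed.

Definition branch_sum n g y : R := \sum_(s <- survivors n y) g (subtree s y).

(** Indicators replace the random index list by a deterministic one, to which linearity of
    expectation applies. *)
Lemma branch_sumE n g y :
  branch_sum n g y = \sum_(s <- words n) (survives y s)%:R * g (subtree s y).
Proof.
rewrite /branch_sum big_filter big_mkcond; apply: eq_bigr => s _.
by case: ifP => _; rewrite ?mul1r ?mul0r.
Qed.

Lemma depends_below (A : Type) s (g : (seq letter -> bool) -> A) : depends D g ->
  depends D (fun y => g (subtree s y)).
Proof. by move=> gD; exact: depends_mono (@below_D s) (depends_subtree s gD). Qed.

Lemma depends_sum (E : set (seq letter)) (J : eqType) (js : seq J)
    (X : J -> (seq letter -> bool) -> R) : (forall j, j \in js -> depends E (X j)) ->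
  depends E (fun y => \sum_(j <- js) X j y).
Proof.
move=> XE; have := depends_comp (fun r : seq R => \sum_(x <- r) x) (depends_map XE).
by congr depends; apply/funext => y /=; rewrite big_map.
Qed.

Lemma depends_branch_sum n g : depends D g -> depends D (branch_sum n g).
Proof.
move=> gD; rewrite (_ : branch_sum n g =
  fun y => \sum_(s <- words n) (survives y s)%:R * g (subtree s y)); last first.
  by apply/funext => y; exact: branch_sumE.
apply: depends_sum => s _; apply: depends_pair.
  exact: depends_mono (@up_to_D (size s)) (depends_survives_real (leqnn _)).
exact: depends_below.
Qed.

Let m : R := M%:R ^+ d * p.

Lemma sum_words n (c : R) : \sum_(s <- @words d M n) (p ^+ n * c) = m ^+ n * c.
Proof.
rewrite big_const_seq count_predT size_words iter_addr_0 -mulr_natl natrX natrX.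
by rewrite /m exprMn mulrA.
Qed.

Lemma expect_branch_sum n g : depends D g -> Ex (branch_sum n g) = m ^+ n * Ex g.
Proof.
move=> gD; rewrite (_ : branch_sum n g =
  fun y => \sum_(s <- words n) (survives y s)%:R * g (subtree s y)); last first.
  by apply/funext => y; exact: branch_sumE.
rewrite (expect_sum p01 Y_iid) => [|s _]; last first.
  apply: depends_pair; last exact: depends_below.
  exact: depends_mono (@up_to_D (size s)) (depends_survives_real (leqnn _)).
rewrite -sum_words; apply: eq_big_seq => s; rewrite mem_words => /eqP sn.
rewrite expect_off_mul ?expect_survives ?sn//.
exact: depends_mono (@up_to_off s) (depends_survives_real (leqnn _)).
Qed.

Lemma expect_off_centred s h g : depends (off s) h -> depends D g -> Ex g = 0 ->
  Ex (fun y => h y * g (subtree s y)) = 0.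
Proof. by move=> hs gD g0; rewrite expect_off_mul// g0 mulr0. Qed.

(** For s <> t of length n, every factor of the cross term except [g (subtree s y)] depends on
    coordinates off [s]. As [g] is centred the cross term vanishes, and only the m^n expected
    diagonal terms remain. *)
Lemma expect_sqr_branch_sum n g : depends D g -> Ex g = 0 ->
  Ex (fun y => branch_sum n g y ^+ 2) = m ^+ n * Ex (fun y => g y ^+ 2).
Proof.
move=> gD g0; under eq_fun do rewrite branch_sumE.
have XD s : depends D (fun y => (survives y s)%:R * g (subtree s y)).
  apply: depends_pair; last exact: depends_below.
  exact: depends_mono (@up_to_D (size s)) (depends_survives_real (leqnn _)).
rewrite expect_sqr_sum ?words_uniq//.
- rewrite -sum_words; apply: eq_big_seq => s; rewrite mem_words => /eqP sn.
  rewrite -sn -expect_survives -(expect_off_mul (s := s)).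
  + by congr expect; apply/funext => y; case: (survives y s); rewrite ?mul1r// !mul0r expr0n.
  + exact: depends_mono (@up_to_off s) (depends_survives_real (leqnn _)).
  + exact: (depends_comp (fun x : R => x ^+ 2)).
- move=> s t; rewrite !mem_words => /eqP sn /eqP tn nst.
  rewrite -[RHS](@expect_off_centred s
    (fun y => (survives y s)%:R * ((survives y t)%:R * g (subtree t y))) g)//.
  + by congr expect; apply/funext => y; ring.
  + apply: depends_pair; first exact: depends_mono (@up_to_off s) (depends_survives_real (leqnn _)).
    apply: depends_pair.
      by apply: depends_mono (@up_to_off s) (depends_survives_real _); rewrite sn tn.
    by apply: depends_mono (below_off _ nst) (depends_subtree t gD); rewrite sn tn.
Qed.

Definition population n y : R := (size (survivors n y))%:R.

Lemma depends_population n : depends (up_to n) (population n).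
Proof. exact: (depends_comp (fun r => (size r)%:R : R) (depends_survivors n)). Qed.

Lemma depends_populationD n : depends D (population n).
Proof. exact: depends_mono (@up_to_D n) (depends_population n). Qed.

Lemma population_branch n l y : population (n + l) y = branch_sum n (population l) y.
Proof.
rewrite /population survivors_cat size_flatten /shape -map_comp sumnE big_map natr_sum.
by apply: eq_bigr => s _ /=; rewrite size_map.
Qed.

Lemma population_branch1 n y : population n y = branch_sum n (fun=> 1) y.
Proof. by rewrite /branch_sum big_const_seq count_predT iter_addr_0. Qed.

Lemma expect_population n : Ex (population n) = m ^+ n.
Proof.
rewrite (_ : population n = branch_sum n (fun=> 1)); last first.
  by apply/funext => y; exact: population_branch1.
by rewrite expect_branch_sum ?expect_cst ?mulr1//; exact: depends_cst.
Qed.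

Lemma expect_centre g : depends D g -> Ex (fun y => g y - Ex g) = 0.
Proof.
move=> gD; rewrite (expectD p01 Y_iid gD (depends_cst _ (- Ex g))).
by rewrite expect_cst subrr.
Qed.

Lemma depends_centre (c : R) g : depends D g -> depends D (fun y => g y - c).
Proof. exact: (depends_comp (fun x => x - c)). Qed.

Lemma branch_sum_centre n g y (c : R) :
  branch_sum n (fun y => g y - c) y = branch_sum n g y - c * population n y.
Proof.
rewrite /branch_sum sumrB; congr (_ - _).
by rewrite big_const_seq count_predT iter_addr_0 mulr_natr.
Qed.

Lemma survives1 y s : size s = 1%N -> survives y s = y s.
Proof.
case: s => [|j []]// _; apply/forallP/idP => [/(_ ord0)//|yj i].
by rewrite ord1.
Qed.

Lemma population_var1 : Ex (fun y => (population 1 y - m) ^+ 2) = m * (1 - p).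
Proof.
pose X s y : R := (y s)%:R - p.
have -> : (fun y => (population 1 y - m) ^+ 2) =
    (fun y => (\sum_(s <- @words d M 1) X s y) ^+ 2).
  apply/funext => y; congr (_ ^+ 2); rewrite sumrB population_branch1 branch_sumE.
  have := sum_words 1 1; rewrite !expr1 !mulr1 => ->; congr (_ - _).
  by apply: eq_big_seq => s; rewrite mem_words => /eqP s1; rewrite mulr1 survives1.
have X1 s : depends [set s] (X s).
  by apply: (depends_comp (fun b : bool => b%:R - p : R)); apply: depends_coord.
have XD s : s \in @words d M 1 -> depends D (X s).
  by rewrite mem_words => s1; apply: depends_mono (X1 s) => _ ->; case: (s) s1.
have X0 s : s \in @words d M 1 -> Ex (X s) = 0.
  rewrite mem_words => s1; have sD : D s by case: (s) s1.
  rewrite -{1}[X s]/(fun y => (y s)%:R - p).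
  have h : depends D (fun y : seq letter -> bool => (y s)%:R : R).
    by apply: (depends_comp (fun b : bool => b%:R : R)); apply: depends_coord.
  by have := expect_centre h; rewrite (expect_coord p01 Y_iid).
rewrite expect_sqr_sum ?words_uniq//.
- rewrite -[m in RHS]expr1 -sum_words; apply: eq_big_seq => s s1.
  have yD : depends D (fun y : seq letter -> bool => (y s)%:R : R).
    apply: (depends_comp (fun b : bool => b%:R : R)); apply: depends_coord.
    by move: s1; rewrite mem_words; case: (s).
  (* An indicator equals its square, so the expression is affine in it and the mean p suffices. *)
  have -> : (fun y => X s y ^+ 2) = (fun y => (1 - 2 * p) * (y s)%:R) \+ (fun=> p ^+ 2).
    by apply/funext => y /=; rewrite /X; case: (y s) => /=; ring.
  rewrite (expectD p01 Y_iid); last 2 first.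
  + exact: (depends_comp (fun x => (1 - 2 * p) * x)).
  + exact: depends_cst.
  rewrite expect_cst (expectZ p01 Y_iid)// (expect_coord p01 Y_iid).
    by rewrite expr1; ring.
  by move: s1; rewrite mem_words; case: (s).
- move=> s t s1 t1 nst; rewrite (expect_indep p01 Y_iid (X1 s) (X1 t)).
  + by rewrite X0// mul0r.
  + by move: s1; rewrite mem_words => s1 _ ->; case: (s) s1.
  + by move: t1; rewrite mem_words => t1 _ ->; case: (t) t1.
  + by apply/seteqP; split => // x [-> st]; move: nst; rewrite st eqxx.
Qed.

(** This solves the recursion Var N_(n+1) = m^n Var N_1 + m^2 Var N_n; the factor m - 1 clears the
    denominator of the geometric sum. *)
Lemma population_var n :
  (m - 1) * Ex (fun y => (population n y - m ^+ n) ^+ 2) =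
  (1 - p) * m ^+ n * (m ^+ n - 1).
Proof.
elim: n => [|n IHn].
  rewrite expr0 subrr mulr0.
  rewrite [X in _ * X](_ : _ = 0) ?mulr0// -[RHS](expect_cst Y 0).
  congr expect; apply/funext => y; rewrite /population /survivors/=.
  rewrite (_ : survives y [::])/= ?subrr ?expr0n//.
  by apply/forallP => -[].
(* N_(n+1) - m^(n+1) = A + m B, where A is the fluctuation of the offspring of generation n and B
   that of N_n. The two are uncorrelated because B is determined by the levels up to n. *)
pose A := branch_sum n (fun y => population 1 y - m).
pose B y := population n y - m ^+ n.
have m1 : Ex (population 1) = m by rewrite expect_population expr1.
have p1D : depends D (fun y => population 1 y - m).
  exact/depends_centre/depends_populationD.
have AD : depends D A by exact: depends_branch_sum.
have BD : depends D B by exact/depends_centre/depends_populationD.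
have ABD : depends D (fun y => A y * B y) by exact: depends_pair.
have A0 : Ex (fun y => population 1 y - m) = 0.
  by rewrite -m1; apply: expect_centre; exact: depends_populationD.
have -> : (fun y => (population n.+1 y - m ^+ n.+1) ^+ 2) =
    (fun y => A y ^+ 2) \+ ((fun y => (2 * m) * (A y * B y)) \+
      (fun y => m ^+ 2 * B y ^+ 2)).
  apply/funext => y /=; rewrite /A /B branch_sum_centre -population_branch addn1 (exprS m).
  by ring.
have A2D : depends D (fun y => A y ^+ 2) by exact: (depends_comp (fun x : R => x ^+ 2)).
have B2D : depends D (fun y => B y ^+ 2) by exact: (depends_comp (fun x : R => x ^+ 2)).
have AB'D : depends D (fun y => (2 * m) * (A y * B y)).
  exact: (depends_comp (fun x => 2 * m * x)).
have B2'D : depends D (fun y => m ^+ 2 * B y ^+ 2).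
  exact: (depends_comp (fun x => m ^+ 2 * x)).
rewrite (expectD p01 Y_iid A2D); last exact: depends_pair.
rewrite (expectD p01 Y_iid AB'D B2'D) (expectZ p01 Y_iid _ ABD) (expectZ p01 Y_iid _ B2D).
rewrite expect_sqr_branch_sum// population_var1.
have -> : Ex (fun y => A y * B y) = 0.
  have -> : (fun y => A y * B y) = fun y => \sum_(s <- words n)
      ((survives y s)%:R * B y) * (population 1 (subtree s y) - m).
    apply/funext => y; rewrite /A branch_sumE mulr_suml.
    by apply: eq_bigr => s _; ring.
  have hD s : s \in @words d M n -> depends (off s) (fun y => (survives y s)%:R * B y).
    rewrite mem_words => /eqP sn; apply: (depends_mono (@up_to_off s)).
    rewrite sn; apply: depends_pair; first by apply: depends_survives_real; rewrite sn.
    exact: (depends_comp (fun x => x - m ^+ n) (depends_population n)).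
  rewrite (expect_sum p01 Y_iid) => [|s sn].
    rewrite big1_seq// => s /andP[_ sn].
    exact: (@expect_off_centred s _ (fun y => population 1 y - m) (hD s sn)).
  apply: depends_pair; last exact: (depends_below s p1D).
  by apply: depends_mono (hD s sn) => t [].
rewrite mulr0 add0r mulrDr [X in _ + X]mulrCA IHn (exprS m n); ring.
Qed.

End branching.

(** * Estimates in mean *)

Section estimates.
Context {R : realType} {disp : measure_display} {T : measurableType disp}.
Variable P : probability T R.
Context {d M : nat} (Y : seq (letter d M) -> {RV P >-> bool}) (p : R).
Notation letter := (letter d M).
Let D : set (seq letter) := [set s | s <> [::]].
Hypothesis p01 : 0 <= p <= 1.
Hypothesis Y_iid : iid_bernoulli D p Y.
Implicit Types (s t : seq letter) (y : seq letter -> bool) (g : (seq letter -> bool) -> R).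

Notation Ex := (expect Y).
Let m : R := M%:R ^+ d * p.
Hypothesis m_gt1 : 1 < m.

Let mn_gt0 n : 0 < m ^+ n.
Proof. by rewrite exprn_gt0// (lt_trans ltr01). Qed.

Let mi_ge0 n : 0 <= m ^- n.
Proof. by rewrite invr_ge0 ltW. Qed.

Let mn_neq0 n : m ^+ n != 0.
Proof. by rewrite gt_eqF. Qed.

Let m1_neq0 : m - 1 != 0.
Proof. by rewrite subr_eq0 gt_eqF. Qed.

Definition norm_var : R := (1 - p) / (m - 1).

Lemma norm_var_ge0 : 0 <= norm_var.
Proof.
case/andP: p01 => _ p1.
by rewrite /norm_var divr_ge0// subr_ge0// ltW.
Qed.

Definition normalize n g y : R := g y / m ^+ n.

Lemma depends_normalize n g : depends D g -> depends D (normalize n g).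
Proof. exact: (depends_comp (fun x => x / m ^+ n)). Qed.

Lemma expect_normalize n g : depends D g -> Ex (normalize n g) = Ex g / m ^+ n.
Proof.
move=> gD; rewrite mulrC -(expectZ p01 Y_iid _ gD).
by congr expect; apply/funext => y; rewrite mulrC.
Qed.

Definition norm_pop n : (seq letter -> bool) -> R := normalize n (population n).

Lemma depends_norm_pop n : depends D (norm_pop n).
Proof. exact/depends_normalize/depends_populationD. Qed.

Lemma expect_norm_pop n : Ex (norm_pop n) = 1.
Proof.
rewrite expect_normalize; last exact: depends_populationD.
by rewrite (expect_population p01 Y_iid) mulfV.
Qed.

Lemma depends_sqr g : depends D g -> depends D (fun y => g y ^+ 2).
Proof. exact: (depends_comp (fun x : R => x ^+ 2)). Qed.

Lemma norm_pop_var n : Ex (fun y => (norm_pop n y - 1) ^+ 2) = norm_var * (1 - m ^- n).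
Proof.
have -> : (fun y => (norm_pop n y - 1) ^+ 2) =
    (fun y => m ^- n ^+ 2 * (population n y - m ^+ n) ^+ 2).
  by apply/funext => y; rewrite /norm_pop /normalize; field.
rewrite (expectZ p01 Y_iid); last exact/depends_sqr/depends_centre/depends_populationD.
apply: (mulfI m1_neq0); rewrite mulrCA (population_var p01 Y_iid) /norm_var -/m.
by field; rewrite mn_neq0.
Qed.

Lemma norm_pop_var_le n : Ex (fun y => (norm_pop n y - 1) ^+ 2) <= norm_var.
Proof.
rewrite norm_pop_var ler_piMr ?norm_var_ge0// lerBlDr lerDl invr_ge0.
exact: ltW.
Qed.

(** The increment is m^-n times a branch sum of the centred [norm_pop l - 1]; orthogonality turns
    the factor m^(-2n) into m^-n. *)
Lemma norm_pop_increment n l :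
  Ex (fun y => (norm_pop (n + l) y - norm_pop n y) ^+ 2) <= norm_var * m ^- n.
Proof.
have lD : depends D (fun y => norm_pop l y - 1).
  exact/depends_centre/depends_norm_pop.
have l0 : Ex (fun y => norm_pop l y - 1) = 0.
  by rewrite -(expect_norm_pop l); apply/(expect_centre p01 Y_iid)/depends_norm_pop.
have -> : (fun y => (norm_pop (n + l) y - norm_pop n y) ^+ 2) =
    (fun y => m ^- n ^+ 2 * branch_sum n (fun y => norm_pop l y - 1) y ^+ 2).
  apply/funext => y; rewrite branch_sum_centre /norm_pop /normalize.
  rewrite population_branch /branch_sum -mulr_suml exprD mul1r.
  by field; rewrite !mn_neq0.
rewrite (expectZ p01 Y_iid); last exact/depends_sqr/depends_branch_sum.
rewrite (expect_sqr_branch_sum p01 Y_iid)// -/m.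
apply: le_trans (_ : m ^- n * Ex (fun y => (norm_pop l y - 1) ^+ 2) <= _).
  by rewrite le_eqVlt; apply/orP; left; apply/eqP; field.
by rewrite mulrC ler_wpM2r ?norm_pop_var_le// invr_ge0 ltW.
Qed.

Lemma norm_pop_sqr n : Ex (fun y => norm_pop n y ^+ 2) = 1 + norm_var * (1 - m ^- n).
Proof.
rewrite -norm_pop_var.
have D1 := depends_centre 1 (depends_norm_pop n).
have -> : (fun y => norm_pop n y ^+ 2) =
    (fun y => (norm_pop n y - 1) ^+ 2) \+ (fun y => 2 * norm_pop n y + -1).
  by apply/funext => y /=; ring.
have D2 := depends_norm_pop n.
have D3 : depends D (fun y => 2 * norm_pop n y) by exact: (depends_comp (fun x => 2 * x)).
have D4 : depends D (fun y => 2 * norm_pop n y + -1).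
  exact: (depends_comp (fun x => 2 * x + -1)).
rewrite (expectD p01 Y_iid (depends_sqr D1) D4).
rewrite (expectD p01 Y_iid D3 (depends_cst _ (-1))) expect_cst.
rewrite (expectZ p01 Y_iid _ D2) expect_norm_pop; ring.
Qed.

Lemma norm_pop_sqr_le n : Ex (fun y => norm_pop n y ^+ 2) <= 1 + norm_var.
Proof. by rewrite norm_pop_sqr lerD2l -norm_pop_var norm_pop_var_le. Qed.

(** [decay ^+ n] is m^(-n/2), the L^2 size of m^-n times a centred sum over about m^n branches. *)
Definition decay : R := (Num.sqrt m)^-1.

Lemma decay_gt0 : 0 < decay.
Proof. by rewrite invr_gt0 sqrtr_gt0 (lt_trans ltr01). Qed.

Lemma decay_lt1 : decay < 1.
Proof. by rewrite invf_lt1 ?sqrtr_gt0 ?(lt_trans ltr01)// -sqrtr1 ltr_sqrt// (lt_trans ltr01). Qed.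

Lemma decay_sqr n : (decay ^+ n) ^+ 2 = m ^- n.
Proof.
rewrite exprAC /decay exprVn sqr_sqrtr ?exprVn//.
by rewrite ltW// (lt_trans ltr01).
Qed.

(* AM-GM in place of Cauchy-Schwarz: [2 |x| <= e + x^2 / e]. *)
Lemma expect_norm_le g n (B : R) : depends D g ->
  Ex (fun y => g y ^+ 2) <= B * m ^- n ->
  Ex (fun y => `|g y|) <= (1 + B) / 2 * decay ^+ n.
Proof.
move=> gD gB; have q0 : 0 < decay ^+ n by rewrite exprn_gt0// decay_gt0.
have gabsD : depends D (fun y => `|g y|) by exact: (depends_comp (fun x : R => `|x|)).
have hD : depends D (fun y => decay ^- n / 2 * g y ^+ 2).
  exact: (depends_comp (fun x => decay ^- n / 2 * x ^+ 2)).
apply: (@le_trans _ _ (Ex (fun y => decay ^- n / 2 * g y ^+ 2 + decay ^+ n / 2))).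
  apply: (expect_le p01 Y_iid gabsD).
    exact: (depends_comp (fun x => decay ^- n / 2 * x ^+ 2 + decay ^+ n / 2)).
  move=> y; rewrite -subr_ge0 -(real_normK (num_real (g y))).
  have -> : decay ^- n / 2 * `|g y| ^+ 2 + decay ^+ n / 2 - `|g y| =
    decay ^- n / 2 * (`|g y| - decay ^+ n) ^+ 2 by field; rewrite gt_eqF.
  by rewrite mulr_ge0 ?sqr_ge0// divr_ge0// invr_ge0 ltW.
rewrite (expectD p01 Y_iid hD (depends_cst _ _)) expect_cst.
rewrite (expectZ p01 Y_iid); last exact: depends_sqr.
apply: (@le_trans _ _ (decay ^- n / 2 * (B * m ^- n) + decay ^+ n / 2)).
  by rewrite lerD2r ler_wpM2l// divr_ge0// invr_ge0 ltW.
rewrite -decay_sqr le_eqVlt; apply/orP; left; apply/eqP.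
by field; rewrite gt_eqF.
Qed.

Lemma norm_pop_increment_norm n l :
  Ex (fun y => `|norm_pop (n + l) y - norm_pop n y|) <= (1 + norm_var) / 2 * decay ^+ n.
Proof.
apply: expect_norm_le (norm_pop_increment n l).
by apply: (depends_pair (fun a b => a - b)); exact: depends_norm_pop.
Qed.

Definition boundary_pop n y : R := (count (@on_boundary d M) (survivors n y))%:R.

Lemma depends_boundary_pop n : depends D (boundary_pop n).
Proof.
apply: depends_mono (@up_to_D d M n) _.
exact: (depends_comp (fun r => (count (@on_boundary d M) r)%:R : R) (depends_survivors n)).
Qed.

Hypothesis d_gt0 : (0 < d)%N.

(** Each word survives with probability p^n, so the factors p^n cancel against m^n = M^(dn) p^n and
    the boundary count M^((d-1)n) loses one power M^n. *)
Lemma expect_boundary_pop n : Ex (boundary_pop n) / m ^+ n <= 2 * d%:R * M%:R ^- n.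
Proof.
have M0 : 0 < M%:R :> R.
  rewrite lt_neqAle ler0n andbT eq_sym; apply: contraTneq m_gt1 => M0.
  by rewrite /m M0 expr0n gtn_eqF//= mul0r -leNgt ler01.
case/andP: p01 => p0 _.
have p0' : 0 < p.
  rewrite lt_neqAle p0 andbT eq_sym; apply: contraTneq m_gt1 => p_0.
  by rewrite /m p_0 mulr0 -leNgt ler01.
have -> : Ex (boundary_pop n) = (count (@on_boundary d M) (words n))%:R * p ^+ n.
  have -> : boundary_pop n =
      fun y => \sum_(s <- words n) (on_boundary s)%:R * (survives y s)%:R.
    apply/funext => y; rewrite /boundary_pop /survivors count_filter -sum1_count natr_sum.
    rewrite big_mkcond; apply: eq_bigr => s _ /=.
    by case: (on_boundary s); case: (survives y s); rewrite /= ?mulr0 ?mul0r ?mulr1.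
  have rD s : depends D (fun y => (survives y s)%:R : R).
    exact: depends_mono (@up_to_D d M (size s)) (depends_survives_real (leqnn _)).
  rewrite (expect_sum p01 Y_iid) => [|s _]; last first.
    exact: (depends_comp (fun x : R => (on_boundary s)%:R * x)).
  rewrite -sum1_count natr_sum mulr_suml [RHS]big_mkcond; apply: eq_big_seq => s.
  rewrite mem_words => /eqP sn.
  rewrite (expectZ p01 Y_iid)// (expect_survives p01 Y_iid) sn.
  by case: ifP => _; rewrite ?mul1r ?mul0r.
rewrite ler_pdivrMr//.
apply: (@le_trans _ _ ((2 * d * (M ^ d.-1) ^ n)%:R * p ^+ n)).
  by rewrite ler_wpM2r ?exprn_ge0// ler_nat count_on_boundary.
have Md : M%:R ^+ d = M%:R * M%:R ^+ d.-1 :> R by rewrite -exprS prednK.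
rewrite !natrM !natrX /m exprMn Md exprMn.
rewrite le_eqVlt; apply/orP; left; apply/eqP.
by field; rewrite expf_neq0// gt_eqF.
Qed.

Variables (X : nat -> (seq letter -> bool) -> R) (C : R).
Hypothesis XD : forall n, depends D (X n).
Hypothesis X_le : forall n y, `|X n y| <= C * population n y.
Hypothesis X_branch : forall n l y,
  `|X (n + l) y - branch_sum n (X l) y| <= C * branch_sum n (boundary_pop l) y.
Hypothesis C_ge0 : 0 <= C.

Let x n := normalize n (X n).
Let a n : R := Ex (x n).

Let xD n : depends D (x n).
Proof. exact: depends_normalize. Qed.

Let nb n l y := branch_sum n (x l) y / m ^+ n.

Let nbD n l : depends D (nb n l).
Proof. exact/(depends_comp (fun x => x / m ^+ n))/depends_branch_sum. Qed.

Let diffD n l : depends D (fun y => x (n + l) y - nb n l y).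
Proof. exact: (depends_pair (fun a b => a - b)). Qed.

Let Ediff n l : Ex (fun y => `|x (n + l) y - nb n l y|) <= C * (2 * d%:R * M%:R ^- l).
Proof.
have bD : depends D (branch_sum n (boundary_pop l)).
  exact/depends_branch_sum/depends_boundary_pop.
apply: (@le_trans _ _ (Ex (fun y => C / m ^+ (n + l) * branch_sum n (boundary_pop l) y))).
  apply: (expect_le p01 Y_iid).
  - exact: (depends_comp (fun x : R => `|x|)).
  - exact: (depends_comp (fun x : R => C / m ^+ (n + l) * x)).
  move=> y; rewrite /x /nb /normalize /branch_sum -mulr_suml -mulrA -invfM -exprD.
  rewrite [(l + n)%N]addnC -mulrBl normrM (ger0_norm (mi_ge0 _)).
  by rewrite mulrAC ler_wpM2r//; exact: X_branch.
rewrite (expectZ p01 Y_iid)// (expect_branch_sum p01 Y_iid) -/m; last first.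
  exact: depends_boundary_pop.
apply: le_trans (ler_wpM2l C_ge0 (expect_boundary_pop l)).
rewrite exprD le_eqVlt; apply/orP; left; apply/eqP.
by field; rewrite !mn_neq0.
Qed.

Let expect_nb n l : Ex (nb n l) = a l.
Proof.
rewrite (expect_normalize n (depends_branch_sum n (xD l))).
by rewrite (expect_branch_sum p01 Y_iid)// mulrC mulKf.
Qed.

(** The main term [nb n l] has mean exactly [a l], so only the boundary error remains, and it does
    not depend on n. *)
Lemma mean_cauchy n l : `|a (n + l) - a l| <= C * (2 * d%:R * M%:R ^- l).
Proof.
apply: le_trans (Ediff n l); rewrite -(expect_nb n l).
have -> : a (n + l) - Ex (nb n l) = Ex (fun y => x (n + l) y - nb n l y).
  have nD : depends D (fun y => -1 * nb n l y) by exact: (depends_comp (fun x => -1 * x)).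
  have := expectD p01 Y_iid (xD (n + l)) nD.
  rewrite (expectZ p01 Y_iid _ (nbD n l)) mulN1r => <-.
  by congr expect; apply/funext => y /=; rewrite mulN1r.
have absD : depends D (fun y => `|x (n + l) y - nb n l y|).
  exact: (depends_comp (fun x : R => `|x|) (diffD n l)).
rewrite ler_norml -mulN1r -(expectZ p01 Y_iid _ absD); apply/andP; split.
  apply: (expect_le p01 Y_iid) => //; first exact: (depends_comp (fun x => -1 * x)).
  by move=> y; rewrite mulN1r lerNl ler_normr lexx orbT.
by apply: (expect_le p01 Y_iid) => // y; exact: ler_norm.
Qed.

Let expect_sqr_x n : Ex (fun y => x n y ^+ 2) <= C ^+ 2 * (1 + norm_var).
Proof.
apply: le_trans (ler_wpM2l (sqr_ge0 C) (norm_pop_sqr_le n)).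
rewrite -(expectZ p01 Y_iid _ (depends_sqr (depends_norm_pop n))).
apply: (expect_le p01 Y_iid (depends_sqr (xD n))).
  exact: (depends_comp (fun x : R => C ^+ 2 * x ^+ 2) (depends_norm_pop n)).
move=> y; rewrite -exprMn -[leLHS](real_normK (num_real _)).
have xC : `|x n y| <= C * norm_pop n y.
  rewrite /x /norm_pop /normalize normrM mulrA (ger0_norm (mi_ge0 _)).
  by rewrite ler_wpM2r.
by rewrite ler_sqr ?nnegrE//; exact: le_trans xC.
Qed.

(** The first term is the boundary error. The second bounds m^-n times a branch sum of [x l - a l],
    whose variance is at most the second moment of [x l], itself at most C^2 times that of
    [norm_pop l]. *)
Lemma expect_approx n l : Ex (fun y => `|x (n + l) y - a l * norm_pop n y|) <=
  C * (2 * d%:R * M%:R ^- l) + (1 + C ^+ 2 * (1 + norm_var)) / 2 * decay ^+ n.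
Proof.
pose z y := nb n l y - a l * norm_pop n y.
have zE y : z y = m ^- n * branch_sum n (fun y => x l y - a l) y.
  by rewrite branch_sum_centre /z /nb /norm_pop /normalize; ring.
have cD : depends D (fun y => x l y - a l) by exact: depends_centre.
have zD : depends D z.
  rewrite (_ : z = fun y => m ^- n * branch_sum n (fun y => x l y - a l) y).
    exact: (depends_comp (fun x => m ^- n * x) (depends_branch_sum n cD)).
  exact/funext.
have a0 : Ex (fun y => x l y - a l) = 0 by exact: (expect_centre p01 Y_iid).
have var_le : Ex (fun y => (x l y - a l) ^+ 2) <= C ^+ 2 * (1 + norm_var).
  apply: le_trans (expect_sqr_x l).
  have -> : (fun y => (x l y - a l) ^+ 2) =
      (fun y => x l y ^+ 2) \+ ((fun y => (- 2 * a l) * x l y) \+ (fun=> a l ^+ 2)).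
    by apply/funext => y /=; ring.
  have D1 : depends D (fun y => - 2 * a l * x l y).
    exact: (depends_comp (fun x => - 2 * a l * x)).
  have D2 : depends D (fun y => - 2 * a l * x l y + a l ^+ 2).
    exact: (depends_comp (fun x => - 2 * a l * x + a l ^+ 2)).
  rewrite (expectD p01 Y_iid (depends_sqr (xD l)) D2).
  rewrite (expectD p01 Y_iid D1 (depends_cst _ _)) expect_cst (expectZ p01 Y_iid _ (xD l)).
  rewrite -/(a l) gerDl (_ : _ + _ = - (a l ^+ 2)); first by rewrite oppr_le0 sqr_ge0.
  by ring.
have z2 : Ex (fun y => z y ^+ 2) <= C ^+ 2 * (1 + norm_var) * m ^- n.
  have -> : (fun y => z y ^+ 2) =
      (fun y => m ^- n ^+ 2 * branch_sum n (fun y => x l y - a l) y ^+ 2).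
    by apply/funext => y; rewrite zE exprMn.
  rewrite (expectZ p01 Y_iid); last exact/depends_sqr/depends_branch_sum.
  rewrite (expect_sqr_branch_sum p01 Y_iid)// -/m.
  apply: (@le_trans _ _ (m ^- n * Ex (fun y => (x l y - a l) ^+ 2))).
    by rewrite le_eqVlt; apply/orP; left; apply/eqP; field.
  by rewrite mulrC ler_wpM2r// invr_ge0 ltW.
apply: le_trans (lerD (Ediff n l) (expect_norm_le zD z2)).
have absD : depends D (fun y => `|x (n + l) y - nb n l y|).
  exact: (depends_comp (fun x : R => `|x|) (diffD n l)).
have zabsD : depends D (fun y => `|z y|) by exact: (depends_comp (fun x : R => `|x|)).
rewrite -(expectD p01 Y_iid absD zabsD); apply: (expect_le p01 Y_iid).
- apply: (depends_pair (fun u v => `|u - a l * v|)) => //; exact: depends_norm_pop.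
- exact: depends_pair.
- by move=> y /=; apply: le_trans (ler_normD _ _); rewrite /z subrKA.
Qed.

End estimates.

(** * Almost sure limits *)

(** Convergence is expressed through upper and lower limits, which depend measurably on a parameter,
    so that the set of convergence is measurable. *)
Lemma cvgnP_limn_esup (R : realType) (u : R^nat) :
  cvgn u <-> limn_esup (EFin \o u) = limn_einf (EFin \o u) /\
             limn_esup (EFin \o u) \is a fin_num.
Proof.
split => [/cvg_ex[l ul]|[supinf fsup]].
  have /cvg_limn_einf_sup[infl supl] : EFin \o u @ \oo --> l%:E.
    by apply: cvg_EFin => //; exact: nearW.
  by rewrite infl supl.
have einfl : einfs (EFin \o u) @ \oo --> limn_esup (EFin \o u).
  by rewrite supinf limn_einf_lim; exact: is_cvg_einfs.
have esupl : esups (EFin \o u) @ \oo --> limn_esup (EFin \o u).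
  by rewrite limn_esup_lim; exact: is_cvg_esups.
have : EFin \o u @ \oo --> limn_esup (EFin \o u).
  apply: squeeze_cvge einfl esupl; apply: nearW => n; apply/andP; split.
    by apply: ereal_inf_lbound; exists n => /=.
  by apply: ereal_sup_ubound; exists n => /=.
rewrite -(fineK fsup) => /fine_cvgP[_ ul]; apply/cvg_ex.
by exists (fine (limn_esup (EFin \o u))).
Qed.

Lemma cvgn_summable_increments (R : realType) (u : R^nat) :
  cvgn (series (fun n => `|u (n + 1)%N - u n|)) -> cvgn u.
Proof.
move=> h.
have /normed_cvg/cvg_ex[l sl] : cvgn [normed series (fun n => u (n + 1)%N - u n)] by [].
apply/cvg_ex; exists (u 0%N + l).
have : u 0%N + series (fun n => u (n + 1)%N - u n) n @[n --> \oo] --> u 0%N + l.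
  by apply: cvgD => //; exact: cvg_cst.
rewrite (_ : (fun n => u 0%N + _) = u)//; apply/funext => n; rewrite /series/= addrC.
elim: n => [|n IHn]; first by rewrite big_geq// add0r.
by rewrite big_nat_recr//= addrAC IHn addn1 addrC subrK.
Qed.

Section limit_of_random_variables.
Context {R : realType} {disp : measure_display} {T : measurableType disp}.

Lemma measurable_lim (h : nat -> T -> R) : (forall n, measurable_fun setT (h n)) ->
  measurable_fun setT (fun w => lim (h n w @[n --> \oo])).
Proof.
move=> mh; pose C := [set w | cvgn (h ^~ w)].
have mesup : measurable_fun setT (fun w => limn_esup (EFin \o (h ^~ w))).
  by apply: (measurable_fun_limn_esup (f := fun n w => (h n w)%:E)) => n; apply/measurable_EFinP.
have meinf : measurable_fun setT (fun w => limn_einf (EFin \o (h ^~ w))).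
  rewrite /limn_einf; apply: measurableT_comp => //.
  apply: (measurable_fun_limn_esup (f := fun n w => (- (h n w)%:E)%E)) => n.
  by apply: measurableT_comp => //; apply/measurable_EFinP.
have mC : measurable C.
  have -> : C = (setT `&` [set w | limn_esup (EFin \o (h ^~ w)) = limn_einf (EFin \o (h ^~ w))])
      `&` (setT `&` [set w | limn_esup (EFin \o (h ^~ w)) \is a fin_num]).
    apply/seteqP; split => w; first by move=> /cvgnP_limn_esup[].
    by move=> [[_ ?] [_ ?]]; apply/cvgnP_limn_esup.
  by apply: measurableI; [exact: measurable_eqe|exact: emeasurable_fin_num].
rewrite -(setvU C) setUC; apply/measurable_funU => //; first exact: measurableC.
split.
  by apply: (measurable_fun_cvg (h := h)) => // n; exact: measurable_funTS.
(* Where the sequence diverges, [lim] returns a fixed default, so the function is constant there. *)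
apply: (eq_measurable_fun (cst (point : R))); last exact: measurable_cst.
move=> w /set_mem nCw; rewrite /= /lim /lim_in.
by rewrite getPN// => l hl; apply: nCw; apply/cvg_ex; exists l.
Qed.

Variable P : probability T R.

(** Monotone convergence makes the sum of the nonnegative [h n] integrable, hence finite almost
    everywhere. *)
Lemma summable_expectation_cvg (h : nat -> T -> R) (e : nat -> R) :
  (forall n, measurable_fun setT (h n)) -> (forall n w, 0 <= h n w) ->
  (forall n, ('E_P[h n] <= (e n)%:E)%E) -> cvgn (series e) ->
  {ae P, forall w, cvgn (series (h ^~ w))}.
Proof.
move=> mh h0 he ce.
have e0 n : 0 <= e n by rewrite -lee_fin (le_trans _ (he n))//; exact: expectation_ge0.
have mEh n : measurable_fun setT (fun w => (h n w)%:E) by exact/measurable_EFinP.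
have mS : measurable_fun setT (fun w => \sum_(n <oo) (h n w)%:E)%E.
  rewrite (_ : (fun w => _) = (fun w => \sum_(n <oo | n \in xpredT) (h n w)%:E)%E).
    by apply: ge0_emeasurable_sum => n; [move=> w _ _; rewrite lee_fin|move=> _; exact: mEh].
  by apply/funext => w; apply: eq_eseriesl.
have intS : P.-integrable setT (fun w => \sum_(n <oo) (h n w)%:E)%E.
  apply/integrableP; split => //.
  under eq_integral => w _.
    rewrite gee0_abs; last by apply: nneseries_ge0 => n _ _; rewrite lee_fin.
    over.
  rewrite integral_nneseries//; last by move=> n w _; rewrite lee_fin.
  apply: (@le_lt_trans _ _ (\sum_(n <oo) (e n)%:E)%E).
    apply: lee_nneseries => [n _ _|n _].
      by apply: integral_ge0 => w _; rewrite lee_fin.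
    by have := he n; rewrite unlock.
  rewrite (_ : (\sum_(n <oo) (e n)%:E)%E = (limn (series e))%:E) ?ltry//.
  rewrite -EFin_lim//; congr (limn _); apply/funext => n /=.
  by rewrite /series/= sumEFin.
have := integrable_ae measurableT intS; apply: filterS => w /(_ I) fS.
by apply: nnseries_is_cvg => //; rewrite ltey_eq fS.
Qed.

End limit_of_random_variables.

(** The exact moments of the limit are obtained in this form: they differ from the claimed values by
    O(q^n) for every n. *)
Lemma geometric_squeeze (R : realType) (x c q : R) : 0 < q < 1 ->
  (forall n, `|x| <= c * q ^+ n) -> x = 0.
Proof.
move=> /andP[q0 q1] xq; apply/eqP; rewrite -normr_le0.
have cq : (fun n => c * q ^+ n) @ \oo --> (0 : R).
  by apply: cvg_geometric; rewrite ger0_norm// ltW.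
by rewrite -(cvg_lim _ cq)//; apply: limr_ge; [apply/cvg_ex; exists 0|exact: nearW].
Qed.

(** * Mean and variance of an almost sure limit *)

Section second_moment_of_limit.
Context {R : realType} {disp : measure_display} {T : measurableType disp}.
Variable P : probability T R.
Implicit Types X Z : T -> R.

Lemma Lfun1_measurable X : X \in Lfun P 1 -> measurable_fun setT X.
Proof. by move=> /Lfun1_integrable/measurable_int/measurable_EFinP. Qed.

Lemma Lfun1_dominated X Z : measurable_fun setT X -> Z \in Lfun P 1 ->
  (forall w, `|X w| <= Z w) -> X \in Lfun P 1.
Proof.
move=> mX /Lfun1_integrable iZ XZ; apply/Lfun1_integrable.
apply: le_integrable iZ => //; first exact/measurable_EFinP.
by move=> w _ /=; rewrite lee_fin; apply: le_trans (XZ w) (ler_norm _).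
Qed.

Lemma Lfun1_bound X (c : R) : measurable_fun setT X -> (forall w, 0 <= X w) ->
  ('E_P[X] <= c%:E)%E -> X \in Lfun P 1.
Proof.
move=> mX X0 Xc; apply/Lfun1_integrable/integrableP; split; first exact/measurable_EFinP.
apply: (@le_lt_trans _ _ 'E_P[X]%E); last exact: le_lt_trans Xc (ltry _).
rewrite unlock le_eqVlt; apply/orP; left; apply/eqP.
by apply: eq_integral => w _ /=; rewrite ger0_norm.
Qed.

Lemma ae_eq_expectation X Z : measurable_fun setT X -> measurable_fun setT Z ->
  {ae P, forall w, X w = Z w} -> 'E_P[X]%E = 'E_P[Z]%E.
Proof.
move=> mX mZ XZ; rewrite unlock; apply: ae_eq_integral => //; try exact/measurable_EFinP.
by apply: filterS XZ => w /= -> _.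
Qed.

Lemma expectation_mono X Z : X \in Lfun P 1 -> Z \in Lfun P 1 ->
  (forall w, X w <= Z w) -> ('E_P[X] <= 'E_P[Z])%E.
Proof.
move=> X1 Z1 XZ; rewrite -sube_ge0; last by rewrite expectation_fin_num.
by rewrite -expectationB//; apply: expectation_ge0 => w; rewrite subr_ge0.
Qed.

Variables (W : nat -> T -> R) (K q c : R).
Hypothesis W_L1 : forall n, W n \in Lfun P 1.
Hypothesis W_sqr_L1 : forall n, (fun w => (W n w - 1) ^+ 2) \in Lfun P 1.
Hypothesis W_mean : forall n, 'E_P[W n]%E = 1%E.
Hypothesis W_var : forall n,
  'E_P[(fun w => (W n w - 1) ^+ 2)%R]%E = (K * (1 - (q ^+ n) ^+ 2))%:E.
Hypothesis W_incr : forall n l,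
  ('E_P[(fun w => (W (n + l)%N w - W n w) ^+ 2)%R] <= (K * (q ^+ n) ^+ 2)%:E)%E.
Hypothesis W_incr_norm : forall n,
  ('E_P[(fun w => `|W (n + 1)%N w - W n w|)%R] <= (c * q ^+ n)%:E)%E.
Hypothesis q01 : 0 < q < 1.

Let mW n : measurable_fun setT (W n). Proof. exact: Lfun1_measurable. Qed.

Let Winf w := lim (W n w @[n --> \oo]).

Let mWinf : measurable_fun setT Winf. Proof. exact: measurable_lim. Qed.

Lemma ae_cvg_increments : {ae P, forall w, cvgn (W ^~ w)}.
Proof.
case/andP: q01 => q0 q1.
have sum_cvg : {ae P, forall w, cvgn (series (fun n => `|W (n + 1)%N w - W n w|))}.
  apply: (@summable_expectation_cvg _ _ _ P (fun n w => `|W (n + 1)%N w - W n w|)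
    (geometric c q)) => //.
  - by move=> n; apply: measurableT_comp => //; exact: measurable_funB.
  - by apply: is_cvg_geometric_series; rewrite ger0_norm// ltW.
by apply: filterS sum_cvg => w /cvgn_summable_increments.
Qed.

(** Fatou's lemma as l grows with n fixed, the bound on W_(n+l) - W_n being uniform in l. The lower
    limit serves as integrand since it exists everywhere. *)
Lemma limit_sub_sqr n :
  ('E_P[(fun w => (Winf w - W n w) ^+ 2)%R] <= (K * (q ^+ n) ^+ 2)%:E)%E.
Proof.
pose f l w := ((W (n + l)%N w - W n w) ^+ 2)%:E.
have mf l : measurable_fun setT (f l).
  by apply/measurable_EFinP/measurable_funX; exact: measurable_funB.
have mliminf : measurable_fun setT (fun w => limn_einf (f ^~ w)).
  rewrite /limn_einf; apply: measurableT_comp => //.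
  apply: (measurable_fun_limn_esup (f := fun l w => (- f l w)%E)) => l.
  exact: measurableT_comp.
have -> : ('E_P[(fun w => (Winf w - W n w) ^+ 2)%R] = \int[P]_w limn_einf (f ^~ w))%E.
  rewrite unlock; apply: ae_eq_integral => //.
    by apply/measurable_EFinP/measurable_funX; exact: measurable_funB.
  apply: filterS ae_cvg_increments => w cW _; apply/esym.
  have fl : f ^~ w @ \oo --> ((Winf w - W n w) ^+ 2)%:E.
    apply: cvg_EFin; first exact: nearW.
    rewrite (_ : fine \o _ = fun l => (W (l + n)%N w - W n w) * (W (l + n)%N w - W n w)).
      rewrite expr2.
      have el : (fun l => W (l + n)%N w - W n w) @ \oo --> Winf w - W n w.
        by apply: cvgB; [rewrite (cvg_shiftn n (W ^~ w))|exact: cvg_cst].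
      exact: (cvgM el el).
    by apply/funext => l /=; rewrite addnC expr2.
  by have [-> _] := cvg_limn_einf_sup fl.
apply: le_trans (fatou _ _ _ _) _ => //.
  by move=> l w _; rewrite lee_fin sqr_ge0.
rewrite limn_einf_lim; apply: lime_le; first exact: is_cvg_einfs.
apply: nearW => l; apply: (@le_trans _ _ (\int[P]_w f l w)%E).
  by apply: ereal_inf_lbound; exists l => /=.
by have := W_incr n l; rewrite unlock.
Qed.

Lemma limit_sub_sqr_L1 n : (fun w => (Winf w - W n w) ^+ 2) \in Lfun P 1.
Proof.
apply: Lfun1_bound (limit_sub_sqr n) => [|w]; last exact: sqr_ge0.
by apply: measurable_funX; exact: measurable_funB.
Qed.

Let Er X := fine 'E_P[X]%E.

Let ErE X : X \in Lfun P 1 -> 'E_P[X]%E = (Er X)%:E.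
Proof. by move=> X1; rewrite /Er fineK// expectation_fin_num. Qed.

Let Er_le X Z : X \in Lfun P 1 -> Z \in Lfun P 1 -> (forall w, X w <= Z w) -> Er X <= Er Z.
Proof. by move=> X1 Z1 XZ; rewrite -lee_fin -!ErE// expectation_mono. Qed.

Let lin_L1 A B (a b e : R) : A \in Lfun P 1 -> B \in Lfun P 1 ->
  (fun w => a * A w + b * B w + e) \in Lfun P 1.
Proof.
move=> A1 B1.
have -> : (fun w => a * A w + b * B w + e) = ((a \o* A) \+ (b \o* B)) \+ cst e.
  by apply/funext => w /=; ring.
by rewrite !rpredD ?Lfun_cst ?Lfun_scale.
Qed.

Let Er_lin A B (a b e : R) : A \in Lfun P 1 -> B \in Lfun P 1 ->
  Er (fun w => a * A w + b * B w + e) = a * Er A + b * Er B + e.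
Proof.
move=> A1 B1; apply: EFin_inj; rewrite -ErE; last exact: lin_L1.
have -> : (fun w => a * A w + b * B w + e) = ((a \o* A) \+ (b \o* B)) \+ cst e.
  by apply/funext => w /=; ring.
rewrite !expectationD ?rpredD ?Lfun_cst ?Lfun_scale//.
by rewrite !expectationZl// expectation_cst !ErE// !EFinD !EFinM.
Qed.

Let A n w := (Winf w - W n w) ^+ 2.
Let B n w := (W n w - 1) ^+ 2.

Let qn_gt0 n : 0 < q ^+ n.
Proof. by case/andP: q01 => q0 _; rewrite exprn_gt0. Qed.

Let qi_ge0 n : 0 <= q ^- n.
Proof. by rewrite invr_ge0 ltW. Qed.

Let ErA n : Er (A n) <= K * (q ^+ n) ^+ 2.
Proof. by rewrite -lee_fin -ErE ?limit_sub_sqr_L1// limit_sub_sqr. Qed.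

Let ErB n : Er (B n) = K * (1 - (q ^+ n) ^+ 2).
Proof. by apply: EFin_inj; rewrite -(ErE (W_sqr_L1 n)) W_var. Qed.

Let ErA_ge0 n : 0 <= Er (A n).
Proof.
rewrite -lee_fin -ErE ?limit_sub_sqr_L1//.
by apply: expectation_ge0 => w; exact: sqr_ge0.
Qed.

Let K_ge0 : 0 <= K.
Proof. by have := le_trans (ErA_ge0 0) (ErA 0); rewrite expr0 expr1n mulr1. Qed.

Lemma limit_L1 : Winf \in Lfun P 1.
Proof.
(* Write Winf = u + v + 1 with u = Winf - W_0 and v = W_0 - 1; since |u| <= u^2 + 1/4 and likewise
   for v, the constant 2 is ample. *)
apply: (Lfun1_dominated mWinf (lin_L1 1 1 2 (limit_sub_sqr_L1 0) (W_sqr_L1 0))) => w.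
rewrite ler_norml; apply/andP; split.
  have : 0 <= (Winf w - W 0 w + 2^-1) ^+ 2 + (W 0 w - 1 + 2^-1) ^+ 2.
    by rewrite addr_ge0// sqr_ge0.
  by rewrite !expr2; lra.
have : 0 <= (Winf w - W 0 w - 2^-1) ^+ 2 + (W 0 w - 1 - 2^-1) ^+ 2.
  by rewrite addr_ge0// sqr_ge0.
by rewrite !expr2; lra.
Qed.

Lemma limit_mean : 'E_P[Winf]%E = 1%E.
Proof.
rewrite (ErE limit_L1); congr EFin; apply/eqP; rewrite -subr_eq0; apply/eqP.
apply: (@geometric_squeeze _ _ ((1 + K) / 2) q) => // n.
pose D w := 1 * Winf w + (- 1) * W n w + 0.
have D1 : D \in Lfun P 1 by exact: lin_L1 limit_L1 (W_L1 n).
have -> : Er Winf - 1 = Er D.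
  rewrite Er_lin ?limit_L1// (_ : Er (W n) = 1); first by ring.
  by apply: EFin_inj; rewrite -ErE.
(* Young's inequality: |D| <= q^-n D^2 / 2 + q^n / 2. The signs s = 1 and s = -1 give the upper and
   the lower bound. *)
pose U (s : R) w := s * (q ^- n / 2) * A n w + 0 * W n w + s * (q ^+ n / 2).
have U1 s : U s \in Lfun P 1 by exact: lin_L1 (limit_sub_sqr_L1 n) (W_L1 n).
have ErU s : Er (U s) = s * ((q ^- n * Er (A n) + q ^+ n) / 2).
  by rewrite Er_lin ?limit_sub_sqr_L1//; ring.
have ErU_le : (q ^- n * Er (A n) + q ^+ n) / 2 <= (1 + K) / 2 * q ^+ n.
  have : q ^- n * Er (A n) <= K * q ^+ n.
    by rewrite ler_pdivrMl// mulrCA -expr2.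
  by lra.
have DU w : 0 <= q ^- n / 2 * (D w + q ^+ n) ^+ 2 /\ 0 <= q ^- n / 2 * (D w - q ^+ n) ^+ 2.
  by split; rewrite mulr_ge0 ?sqr_ge0// divr_ge0// invr_ge0 ltW.
have qn0 : q ^+ n != 0 by rewrite gt_eqF.
rewrite ler_norml; apply/andP; split.
  apply: le_trans (Er_le (U1 (-1)) D1 _); first by rewrite ErU; lra.
  move=> w; rewrite -subr_ge0; have [h _] := DU w; move: h; congr (_ <= _).
  by rewrite /U /D /A; field.
apply: le_trans (Er_le D1 (U1 1) _) _; last by rewrite ErU; lra.
move=> w; rewrite -subr_ge0; have [_ h] := DU w; move: h; congr (_ <= _).
by rewrite /U /D /A; field.
Qed.

Lemma limit_sqr_L1 : (fun w => (Winf w - 1) ^+ 2) \in Lfun P 1.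
Proof.
apply: (@Lfun1_dominated _ (fun w => 2 * A 0 w + 2 * B 0 w + 0)).
- by apply: measurable_funX; exact: measurable_funB.
- exact: lin_L1 (limit_sub_sqr_L1 0) (W_sqr_L1 0).
move=> w; rewrite ger0_norm ?sqr_ge0// -subr_ge0.
have : 0 <= (Winf w - W 0 w - (W 0 w - 1)) ^+ 2 by exact: sqr_ge0.
by congr (_ <= _); rewrite /A /B; ring.
Qed.

Lemma limit_var : 'E_P[(fun w => (Winf w - 1) ^+ 2)%R]%E = K%:E.
Proof.
rewrite (ErE limit_sqr_L1); congr EFin; apply/eqP; rewrite -subr_eq0; apply/eqP.
apply: (@geometric_squeeze _ _ (4 * K) q) => // n.
have qn0 : q ^+ n != 0 by rewrite gt_eqF.
have q1 : q ^+ n <= 1 by case/andP: q01 => q0 q1; rewrite exprn_ile1// ltW.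
(* Expand (u + v)^2 with u = Winf - W_n, v = W_n - 1 and use 2 |u v| <= q^-n u^2 + q^n v^2; s = 1 is
   the upper and s = -1 the lower bound. In the lower one the errors reach K (2 q^n + 2 q^(2n)),
   whence the constant 4. *)
pose U (s : R) w := s * (1 + q ^- n) * A n w + (1 + s * q ^+ n) * B n w + 0.
have U1 s : U s \in Lfun P 1 by exact: lin_L1 (limit_sub_sqr_L1 n) (W_sqr_L1 n).
have ErU s : Er (U s) = s * (1 + q ^- n) * Er (A n) + (1 + s * q ^+ n) * Er (B n) + 0.
  exact: Er_lin (limit_sub_sqr_L1 n) (W_sqr_L1 n).
have hA : (1 + q ^- n) * Er (A n) <= K * (q ^+ n) ^+ 2 + K * q ^+ n.
  rewrite mulrDl mul1r lerD ?ErA// ler_pdivrMl// mulrCA -expr2.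
  exact: ErA.
have Kq : 0 <= K * (q ^+ n - (q ^+ n) ^+ 2).
  by rewrite mulr_ge0// subr_ge0 expr2 ler_piMr// ltW.
have Kq1 : 0 <= K * q ^+ n by rewrite mulr_ge0// ltW.
have Kq3 : 0 <= K * (q ^+ n * (q ^+ n) ^+ 2) by rewrite !mulr_ge0// ?sqr_ge0// ltW.
rewrite ler_norml; apply/andP; split.
  rewrite lerBrDr; apply: le_trans (Er_le (U1 (-1)) limit_sqr_L1 _).
    by rewrite ErU ErB; lra.
  move=> w; rewrite -subr_ge0.
  have : 0 <= 2 * A n w + q ^- n * ((Winf w - W n w) + q ^+ n * (W n w - 1)) ^+ 2.
    by apply: addr_ge0; apply: mulr_ge0 => //; exact: sqr_ge0.
  by congr (_ <= _); rewrite /U /A /B; field.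
rewrite lerBlDr; apply: le_trans (Er_le limit_sqr_L1 (U1 1) _) _.
  move=> w; rewrite -subr_ge0.
  have : 0 <= q ^- n * ((Winf w - W n w) - q ^+ n * (W n w - 1)) ^+ 2.
    by rewrite mulr_ge0 ?sqr_ge0// invr_ge0 ltW.
  by congr (_ <= _); rewrite /U /A /B; field.
by rewrite ErU ErB; lra.
Qed.

End second_moment_of_limit.

Lemma cvg_half : half n @[n --> \oo] --> \oo.
Proof.
apply/cvgnyPge => A; near=> n.
by rewrite geq_half_double; near: n; exists A.*2.
Unshelve. all: by end_near. Qed.

Lemma cvg_uphalf : uphalf n @[n --> \oo] --> \oo.
Proof.
apply/cvgnyPge => A; near=> n.
rewrite uphalfE geq_half_double; apply: leqW; near: n; exists A.*2 => //.
Unshelve. all: by end_near. Qed.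

(** * Almost sure convergence of the normalised functionals *)

Section almost_sure_limit.
Context {R : realType} {disp : measure_display} {T : measurableType disp}.
Variable P : probability T R.
Context {d M : nat} (Y : seq (letter d M) -> {RV P >-> bool}) (p : R).
Notation letter := (letter d M).
Let D : set (seq letter) := [set s | s <> [::]].
Hypothesis p01 : 0 <= p <= 1.
Hypothesis Y_iid : iid_bernoulli D p Y.
Hypothesis d_gt0 : (0 < d)%N.
Hypothesis M_gt1 : (1 < M)%N.
Let m : R := M%:R ^+ d * p.
Hypothesis m_gt1 : 1 < m.

Let m_gt0 : 0 < m. Proof. exact: lt_trans m_gt1. Qed.

Let q : R := @decay R d M p.

Let K : R := @norm_var R d M p.

Let q01 : 0 < q < 1.
Proof. by rewrite decay_gt0 ?decay_lt1. Qed.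

Let Wn n w : R := norm_pop p n (field Y w).

Definition martingale_limit w : R := lim (norm_pop p n (field Y w) @[n --> \oo]).

Let expE g : depends D g -> 'E_P[g \o field Y]%E = (expect Y g)%:E.
Proof. exact: (expectE p01 Y_iid). Qed.

Let WD n : depends D (norm_pop p n : (seq letter -> bool) -> R).
Proof. exact: depends_norm_pop. Qed.

Let W_L1 n : Wn n \in Lfun P 1.
Proof. exact: depends_Lfun (WD n). Qed.

Let W_incr_norm n :
  ('E_P[(fun w => `|Wn (n + 1)%N w - Wn n w|)%R] <= ((1 + K) / 2 * q ^+ n)%:E)%E.
Proof.
have gD : depends D (fun y => `|norm_pop p (n + 1) y - norm_pop p n y|).
  exact: (depends_pair (fun a b : R => `|a - b|)).
by rewrite (expE gD) lee_fin (norm_pop_increment_norm p01 Y_iid m_gt1).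
Qed.

Lemma martingale_ae_cvg : {ae P, forall w, cvgn (Wn ^~ w)}.
Proof. exact: ae_cvg_increments W_L1 W_incr_norm q01. Qed.

Let qsqr n : (q ^+ n) ^+ 2 = m ^- n.
Proof. exact: decay_sqr. Qed.

Let W_sqr_D n : depends D (fun y => (norm_pop p n y - 1) ^+ 2 : R).
Proof. exact: (depends_comp (fun x : R => (x - 1) ^+ 2)). Qed.

Let W_sqr_L1 n : (fun w => (Wn n w - 1) ^+ 2) \in Lfun P 1.
Proof. exact: depends_Lfun (W_sqr_D n). Qed.

Let W_mean n : 'E_P[Wn n]%E = 1%E.
Proof. by rewrite (expE (WD n)) (expect_norm_pop p01 Y_iid m_gt1). Qed.

Let W_var n :
  'E_P[(fun w => (Wn n w - 1) ^+ 2)%R]%E = (K * (1 - (q ^+ n) ^+ 2))%:E.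
Proof. by rewrite (expE (W_sqr_D n)) (norm_pop_var p01 Y_iid m_gt1) qsqr. Qed.

Let W_incr n l :
  ('E_P[(fun w => (Wn (n + l)%N w - Wn n w) ^+ 2)%R] <= (K * (q ^+ n) ^+ 2)%:E)%E.
Proof.
have gD : depends D (fun y => (norm_pop p (n + l) y - norm_pop p n y) ^+ 2).
  exact: (depends_pair (fun a b : R => (a - b) ^+ 2)).
by rewrite (expE gD) lee_fin qsqr (norm_pop_increment p01 Y_iid m_gt1).
Qed.

Lemma martingale_limit_L1 : martingale_limit \in Lfun P 1.
Proof. exact: (limit_L1 W_L1 W_sqr_L1 W_incr W_incr_norm q01). Qed.

Lemma martingale_limit_mean : 'E_P[martingale_limit]%E = 1%E.
Proof. exact: (limit_mean W_L1 W_sqr_L1 W_mean W_incr W_incr_norm q01). Qed.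

Lemma martingale_limit_sqr_L1 : (fun w => (martingale_limit w - 1) ^+ 2) \in Lfun P 1.
Proof. exact: (limit_sqr_L1 W_L1 W_sqr_L1 W_incr W_incr_norm q01). Qed.

Lemma martingale_limit_var :
  'E_P[(fun w => (martingale_limit w - 1) ^+ 2)%R]%E = (@norm_var R d M p)%:E.
Proof. exact: (limit_var W_L1 W_sqr_L1 W_var W_incr W_incr_norm q01). Qed.

Variables (X : nat -> (seq letter -> bool) -> R) (C : R).
Hypothesis XD : forall n, depends D (X n).
Hypothesis X_le : forall n y, `|X n y| <= C * population n y.
Hypothesis X_branch : forall n l y,
  `|X (n + l) y - branch_sum n (X l) y| <= C * branch_sum n (boundary_pop l) y.
Hypothesis C_ge0 : 0 <= C.

Let x n := normalize p n (X n).
Let a n : R := expect Y (x n).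

Let xD n : depends D (x n).
Proof. exact: depends_normalize. Qed.

Let Mi_ge0 : 0 <= M%:R^-1 :> R.
Proof. by rewrite invr_ge0. Qed.

Let Mi_lt1 : M%:R^-1 < 1 :> R.
Proof. by rewrite invf_lt1 ?ltr1n// ltr0n ltnW. Qed.

(** One outer level in [mean_cauchy] compares consecutive means, with errors M^-n that are
    summable. *)
Lemma mean_cvg : cvgn a.
Proof.
apply: cvgn_summable_increments.
apply: (@series_le_cvg _ _ (geometric (C * (2 * d%:R)) (M%:R^-1))) => [//|n|n|].
- by rewrite /= mulr_ge0 ?mulr_ge0// exprn_ge0.
- rewrite [(n + 1)%N]addnC /= exprVn -mulrA.
  exact: (mean_cauchy p01 Y_iid m_gt1 d_gt0 XD X_branch C_ge0 1 n).
- by apply: is_cvg_geometric_series; rewrite ger0_norm.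
Qed.

Let B : R := (1 + C ^+ 2 * (1 + K)) / 2.

Let B_ge0 : 0 <= B.
Proof.
have K0 : 0 <= K by exact: norm_var_ge0.
by rewrite divr_ge0// addr_ge0// mulr_ge0 ?sqr_ge0// addr_ge0.
Qed.

(** The bound of [expect_approx] when n is split into [uphalf n] outer and [n./2] inner levels. *)
Let e n : R := C * (2 * d%:R * M%:R ^- n./2) + B * q ^+ (uphalf n).

Let e_cvg : cvgn (series e).
Proof.
case/andP: q01 => q0 q1.
pose theta := Num.max q M%:R^-1.
have t0 : 0 < theta by rewrite lt_max q0.
have t1 : theta < 1 by rewrite gt_max q1 Mi_lt1.
pose rho := Num.sqrt theta.
have r0 : 0 < rho by rewrite sqrtr_gt0.
have r1 : rho < 1 by rewrite -sqrtr1 ltr_sqrt.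
(* Both terms are controlled by theta^(n./2) = rho^(2 n./2); the division by rho pays for the
   rounding when n is odd. *)
pose E := (C * (2 * d%:R) + B) / rho.
have CB0 : 0 <= C * (2 * d%:R) + B by apply: addr_ge0 => //; exact: mulr_ge0.
have E0 : 0 <= E by exact: divr_ge0 CB0 (ltW r0).
have e0 n : 0 <= e n.
  rewrite /e; apply: addr_ge0; apply: mulr_ge0 => //; last exact/exprn_ge0/ltW.
apply: (@series_le_cvg _ e (geometric E rho)) => // [n|n|].
- by apply: mulr_ge0 => //; exact/exprn_ge0/ltW.
- apply: (@le_trans _ _ ((C * (2 * d%:R) + B) * theta ^+ n./2)).
    rewrite mulrDl /e -exprVn; apply: lerD.
      rewrite (mulrA C (2 * d%:R)); apply: ler_wpM2l; first exact: mulr_ge0.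
      by rewrite lerXn2r ?nnegrE ?(ltW t0)// le_max lexx orbT.
    apply: ler_wpM2l => //; apply: (@le_trans _ _ (q ^+ n./2)).
      by apply: ler_wiXn2l; rewrite ?(ltW q0) ?(ltW q1)// uphalf_half leq_addl.
    by rewrite lerXn2r ?nnegrE ?(ltW t0) ?(ltW q0)// le_max lexx.
  rewrite /= /E -mulrA ler_wpM2l//.
  rewrite ler_pdivlMl// -(sqr_sqrtr (ltW t0)) -exprM -exprS.
  apply: ler_wiXn2l; [exact: ltW|exact: ltW|].
  by rewrite mul2n -{1}(odd_double_half n) -add1n leq_add2r; case: (odd n).
- by apply: is_cvg_geometric_series; rewrite ger0_norm// ltW.
Qed.

Lemma ae_cvg_martingale_limit :
  {ae P, forall w, x n (field Y w) @[n --> \oo] --> lim (a n @[n --> \oo]) * martingale_limit w}.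
Proof.
(* These errors have summable expectations, so almost surely their series converges and they tend to
   0; the approximants converge because both halves of n tend to infinity. *)
pose g n y : R := `|x n y - a n./2 * norm_pop p (uphalf n) y|.
have gD n : depends D (g n).
  exact: (depends_pair (fun u v : R => `|u - a n./2 * v|)).
have : {ae P, forall w, cvgn (series (fun n => g n (field Y w)))}.
  apply: (@summable_expectation_cvg _ _ _ P (fun n w => g n (field Y w)) e) => //.
  - by move=> n; exact: Lfun1_measurable (depends_Lfun Y (gD n)).
  - by move=> n w; exact: normr_ge0.
  - move=> n; rewrite (expE (gD n)) lee_fin.
    have := expect_approx p01 Y_iid m_gt1 d_gt0 XD X_le X_branch C_ge0 (uphalf n) n./2.
    by rewrite uphalf_half -addnA addnn odd_double_half -uphalf_half.
apply: filterS2 martingale_ae_cvg => w cW /cvg_series_cvg_0 g0.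
have d0 : x n (field Y w) - a n./2 * Wn (uphalf n) w @[n --> \oo] --> 0.
  exact/norm_cvg0P.
have aW : a n./2 * Wn (uphalf n) w @[n --> \oo] --> lim (a n @[n --> \oo]) * martingale_limit w.
  apply: cvgM; first exact: (cvg_comp _ _ cvg_half mean_cvg).
  exact: (cvg_comp _ _ cvg_uphalf cW).
rewrite -[X in _ --> X]add0r.
rewrite (_ : (fun n => x n (field Y w)) = fun n =>
  (x n (field Y w) - a n./2 * Wn (uphalf n) w) + a n./2 * Wn (uphalf n) w).
  exact: cvgD.
by apply/funext => n; rewrite subrK.
Qed.

End almost_sure_limit.

(** * Fractal percolation *)

Section fractal_percolation_limits.
Context {R : realType} {disp : measure_display} {T : measurableType disp}.
Variable P : probability T R.
Context {d M : nat} (Y : seq (letter d M) -> {RV P >-> bool}) (p : R).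
Variable V : 'I_d.+1 -> set 'rV[R]_d -> R.
Notation letter := (letter d M).
Let D : set (seq letter) := [set s | s <> [::]].
Hypothesis p01 : 0 <= p <= 1.
Hypothesis Y_iid : iid_bernoulli D p Y.
Hypothesis d_gt0 : (0 < d)%N.
Hypothesis M_gt1 : (1 < M)%N.
Let m : R := M%:R ^+ d * p.
Hypothesis m_gt1 : 1 < m.
Hypothesis V_intrinsic : intrinsic_volumes V.

Let M_gt0 : (0 < M)%N. Proof. exact: ltnW. Qed.

Let m_gt0 : 0 < m. Proof. exact: lt_trans m_gt1. Qed.

Lemma Ncubes_population n w : (Ncubes Y n w)%:R = population n (field Y w) :> R.
Proof.
congr _%:R; rewrite /Ncubes cardE -(size_map val).
apply: perm_size; apply: uniq_perm.
- by rewrite map_inj_uniq ?enum_uniq//; exact: val_inj.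
- by rewrite filter_uniq// words_uniq.
move=> s; rewrite mem_survivors; apply/mapP/andP => [[t + ->]|[rs sn]].
  by rewrite mem_enum inE => rt; split; rewrite ?size_tuple.
by exists (Tuple sn); rewrite // mem_enum inE.
Qed.

Lemma W_norm_pop n w : W Y n w = norm_pop p n (field Y w).
Proof.
rewrite /W Ncubes_population /norm_pop /normalize; congr (_ / _).
rewrite (_ : (fun w' => (Ncubes Y n w')%:R) = population n \o field Y).
  by rewrite (expectE p01 Y_iid) ?(expect_population p01 Y_iid)//; exact: depends_populationD.
by apply/funext => w'; exact: Ncubes_population.
Qed.

Lemma W_infty_martingale_limit w : W_infty Y w = martingale_limit Y p w.
Proof.
by rewrite /W_infty; under eq_fun do rewrite W_norm_pop.
Qed.

Lemma Flevel_retained_union n w :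
  Flevel Y n w = retained_union n (field Y w) :> set 'rV[R]_d.
Proof. by rewrite retained_unionE. Qed.

(** D is defined so that M^D = m, which turns the real exponent into integer powers. *)
Lemma powR_Dim (k n : nat) :
  M%:R `^ ((k%:R - Dim d M p) * n%:R) = M%:R ^+ (k * n) / m ^+ n.
Proof.
have M0 : 0 < M%:R :> R by rewrite ltr0n.
have lnM : ln M%:R != 0 :> R by rewrite gt_eqF// ln_gt0// ltr1n.
rewrite powRrM powR_mulrn ?powR_ge0// exprM -expr_div_n; congr (_ ^+ n).
rewrite /powR (gt_eqF M0) mulrBl expRB expRM_natl (lnK M0) /Dim -/m divfK//.
by rewrite (lnK m_gt0).
Qed.

Lemma depends_vol_k k n : depends D (vol_k V k n).
Proof.
apply: (depends_mono (@up_to_D d M n)).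
exact: (depends_comp (fun r => M%:R ^+ (k * n) * V k (\big[setU/set0]_(s <- r) cube s) : R)
  (depends_survivors n)).
Qed.

Lemma Z_term (k : 'I_d.+1) n w :
  M%:R `^ ((k%:R - Dim d M p) * n%:R) * V k (Flevel Y n w) =
  normalize p n (vol_k V k n) (field Y w).
Proof. by rewrite powR_Dim Flevel_retained_union /normalize /vol_k mulrAC. Qed.

Lemma Vbar_mean k : Vbar Y V p k =
  lim (expect Y (normalize p n (vol_k V k n)) @[n --> \oo]).
Proof.
rewrite /Vbar; congr (lim (_ @ \oo)); apply/funext => n.
pose v (y : seq letter -> bool) := V k (retained_union n y).
have vD : depends D v.
  apply: (depends_mono (@up_to_D d M n)).
  exact: (depends_comp (fun r => V k (\big[setU/set0]_(s <- r) cube s)) (depends_survivors n)).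
rewrite [n%:R * _]mulrC powR_Dim (expect_normalize p01 Y_iid); last exact: depends_vol_k.
rewrite /vol_k (expectZ p01 Y_iid _ vD) (_ : V k \o _ = v \o field Y).
  by rewrite (expectE p01 Y_iid vD)/= mulrAC.
by apply/funext => w /=; rewrite Flevel_retained_union.
Qed.

Let C k : R := 2 * (2 ^+ (3 ^ d) * face_bound V k).

Let C_ge0 k : 0 <= C k.
Proof. by rewrite !mulr_ge0 ?exprn_ge0// sumr_ge0. Qed.

Lemma Z_infty_ae k :
  {ae P, forall w, Z_infty Y V p k w = Vbar Y V p k * W_infty Y w}.
Proof.
have := ae_cvg_martingale_limit p01 Y_iid d_gt0 M_gt1 m_gt1 (depends_vol_k k)
  (vol_k_bound M_gt0 k V_intrinsic) (vol_k_branch M_gt0 k V_intrinsic) (C_ge0 k).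
apply: filterS => w; rewrite -Vbar_mean -W_infty_martingale_limit => cZ.
rewrite /Z_infty; apply: cvg_lim => //.
by under eq_fun do rewrite Z_term.
Qed.

Lemma measurable_Z_infty k : measurable_fun setT (Z_infty Y V p k).
Proof.
apply: measurable_lim => n.
rewrite (_ : (fun w => _) = normalize p n (vol_k V k n) \o field Y).
  exact: Lfun1_measurable (depends_Lfun Y (depends_normalize p n (depends_vol_k k n))).
by apply/funext => w; exact: Z_term.
Qed.

Let WE : W_infty Y = martingale_limit Y p.
Proof. by apply/funext => w; exact: W_infty_martingale_limit. Qed.

Lemma measurable_W_infty : measurable_fun setT (W_infty Y : T -> R).
Proof. by rewrite WE; exact/Lfun1_measurable/martingale_limit_L1. Qed.

Lemma W_infty_mean : 'E_P[W_infty Y]%E = 1%E.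
Proof. by rewrite WE martingale_limit_mean. Qed.

Lemma Z_infty_mean k : 'E_P[Z_infty Y V p k]%E = (Vbar Y V p k)%:E.
Proof.
rewrite (ae_eq_expectation (measurable_Z_infty k) _ (Z_infty_ae k)); last first.
  by apply: measurable_funM => //; exact: measurable_W_infty.
rewrite (_ : (fun w => _) = Vbar Y V p k \o* W_infty Y); last first.
  by apply/funext => w /=; rewrite mulrC.
by rewrite expectationZl ?W_infty_mean ?mule1// WE martingale_limit_L1.
Qed.

(** Almost everywhere both centred variables are multiples of the same W_infty - 1, so their product
    is a multiple of (W_infty - 1)^2. *)
Lemma Z_infty_covariance k l : covariance P (Z_infty Y V p k) (Z_infty Y V p l) =
  (Vbar Y V p k * Vbar Y V p l * ((1 - p) / (M%:R ^+ d * p - 1)))%:E.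
Proof.
rewrite unlock !Z_infty_mean/=.
have mZ i : measurable_fun setT (Z_infty Y V p i \- cst (Vbar Y V p i)).
  by apply: measurable_funB => //; exact: measurable_Z_infty.
pose S w := (W_infty Y w - 1) ^+ 2 : R.
rewrite (ae_eq_expectation (Z := (Vbar Y V p k * Vbar Y V p l) \o* S)).
- rewrite expectationZl /S; last by rewrite WE martingale_limit_sqr_L1.
  by rewrite WE (martingale_limit_var p01 Y_iid m_gt1) -EFinM.
- exact: measurable_funM.
- apply: measurable_funM => //; apply: measurable_funX; apply: measurable_funB => //.
  exact: measurable_W_infty.
- apply: filterS2 (Z_infty_ae k) (Z_infty_ae l) => w /= Zk Zl.
  transitivity ((Z_infty Y V p k w - Vbar Y V p k) * (Z_infty Y V p l w - Vbar Y V p l)) => //.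
  by rewrite Zk Zl /S; ring.
Qed.

Lemma W_infty_variance : 'V_P[W_infty Y]%E = ((1 - p) / (M%:R ^+ d * p - 1))%:E.
Proof.
rewrite /variance unlock W_infty_mean /= WE -(martingale_limit_var p01 Y_iid m_gt1).
by congr expectation; apply/funext => w; rewrite expr2.
Qed.

End fractal_percolation_limits.

Theorem corollary2p1 (R : realType) (disp : measure_display)
  (T : measurableType disp) (P : probability T R) (d M : nat) (p : R)
  (V : 'I_d.+1 -> set 'rV[R]_d -> R)
  (Y : seq (letter d M) -> {RV P >-> bool})
  (d_ge1 : (1 <= d)%N) (M_ge2 : (2 <= M)%N)
  (p_gt : (M%:R ^+ d)^-1 < p) (p_le1 : p <= 1)
  (V_intrinsic : intrinsic_volumes V)
  (Y_iid : iid_bernoulli [set s | s <> [::]] p Y) :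
  (forall k : 'I_d.+1,
    [/\ 'E_P[Z_infty Y V p k]%E = (Vbar Y V p k)%:E,
        ('V_P[Z_infty Y V p k] < +oo)%E,
        p < 1 -> Vbar Y V p k != 0 -> (0 < 'V_P[Z_infty Y V p k])%E,
        'V_P[Z_infty Y V p k] =
          ((Vbar Y V p k ^+ 2)%:E * 'V_P[W_infty Y])%E &
        'V_P[Z_infty Y V p k] =
          (Vbar Y V p k ^+ 2 * ((1 - p) / (M%:R ^+ d * p - 1)))%:E]) /\
  (forall k l : 'I_d.+1,
    covariance P (Z_infty Y V p k) (Z_infty Y V p l) =
      ((Vbar Y V p k * Vbar Y V p l)%:E * 'V_P[W_infty Y])%E /\
    covariance P (Z_infty Y V p k) (Z_infty Y V p l) =
      (Vbar Y V p k * Vbar Y V p l * ((1 - p) / (M%:R ^+ d * p - 1)))%:E).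
Proof.
have m_gt1 : 1 < M%:R ^+ d * p.
  by rewrite -ltr_pdivrMl ?mulr1// exprn_gt0// ltr0n ltnW.
have p01 : 0 <= p <= 1.
  by rewrite p_le1 andbT; apply: le_trans (ltW p_gt); rewrite invr_ge0 exprn_ge0.
have cov := Z_infty_covariance p01 Y_iid d_ge1 M_ge2 m_gt1 V_intrinsic.
have varW := W_infty_variance p01 Y_iid m_gt1.
split=> [k|k l]; last by rewrite cov varW -EFinM.
have varZ : 'V_P[Z_infty Y V p k]%E =
    (Vbar Y V p k ^+ 2 * ((1 - p) / (M%:R ^+ d * p - 1)))%:E.
  by rewrite /variance cov expr2.
split; rewrite ?varZ ?varW ?ltry ?EFinM//.
  exact: Z_infty_mean.
(* By the formula the variance vanishes when p = 1 or Vbar_k = 0; the two conditions make its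
   factors positive. *)
move=> p_lt1 Vk0; rewrite -EFinM lte_fin mulr_gt0//.
  by rewrite lt_neqAle sqr_ge0 andbT eq_sym sqrf_eq0.
by rewrite divr_gt0 ?subr_gt0.
Qed.
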